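(* For any arbitrarily small constant $\epsilon>0$, there is a polynomial-time algorithm that computes a feasible solution to the linear program LP(Hopset) whose objective value is at most $(1+\epsilon)$ times the optimal value of LP(Hopset).
   Context: Let $G=(V,E)$ be a directed graph with $n=|V|$, edge lengths $\ell:E\to\{1,\dots,\mathrm{poly}(n)\}$, demand pairs $\mathcal{D}\subseteq V\times V$, distance bounds $Dist:\mathcal{D}\to\mathbb{N}_{\ge0}$, and hopbound $\beta$. Let $G_M=(V,E_M)$ be the weighted transitive closure of $G$ ($(u,v)\in E_M$ iff $v$ is reachable from $u$, with length $d_G(u,v)$), and $\widetilde{E}=E_M\setminus E$. For $(s,t)\in\mathcal{D}$, let $\mathcal{P}_{s,t}$ be the set of $s$–$t$ paths in $G_M$ with at most $\beta$ edges and length at most $Dist(s,t)$, and $\mathcal{Z}_{s,t}=\{\mathbf{z}\in[0,1]^{|E_M|}: \sum_{e\in P} z_e\ge 1\ \forall P\in\mathcal{P}_{s,t}\}$. LP(Hopset) is: minimize $\sum_{e\in\widetilde{E}} x_e$ subject to $\sum_{e\in E_M} z_e x_e\ge 1$ for all $(s,t)\in\mathcal{D}$ and all $\mathbf{z}\in\mathcal{Z}_{s,t}$, and $x_e\ge 0$ for all $e\in E_M$. *)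

(* Defs.v *)
From HB Require Import structures.
From mathcomp Require Import all_boot all_order all_algebra.
From mathcomp Require Import all_classical all_reals.

Set Implicit Arguments.
Unset Strict Implicit.
Unset Printing Implicit Defensive.
Import Order.TTheory GRing.Theory Num.Theory.

(* Model of computation: while programs over binary trees with natural       *)
(* numbers at the leaves, under the logarithmic (bit) cost criterion. Every   *)
(* step is charged the bit size of the data it reads and writes, so running   *)
(* times agree with those of Turing machines up to a polynomial.              *)
Inductive data := Leaf of nat | Pair of data & data.

(* [up_log 2 n.+1] is the length of the binary expansion of [n]. *)
Fixpoint dsize (d : data) : nat :=
  match d with
  | Leaf n => (up_log 2 n.+1).+1
  | Pair a b => (dsize a + dsize b).+1
  end.

(* The number held by a leaf; 0 on pairs, so that all primitives are total. *)
Definition dnat (d : data) : nat := if d is Leaf n then n else 0.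

Inductive prim :=
  | Id | Const of nat | Fst | Snd | IsPair | Add | Minus | Mul | Div | Leq.

Definition dfst (d : data) : data := if d is Pair a _ then a else Leaf 0.
Definition dsnd (d : data) : data := if d is Pair _ b then b else Leaf 0.

Definition prim_eval (o : prim) (d : data) : data :=
  let a := dnat (dfst d) in
  let b := dnat (dsnd d) in
  match o with
  | Id => d
  | Const k => Leaf k
  | Fst => dfst d
  | Snd => dsnd d
  | IsPair => Leaf (if d is Pair _ _ then 1 else 0)
  | Add => Leaf (a + b)
  | Minus => Leaf (a - b)
  | Mul => Leaf (a * b)
  | Div => Leaf (a %/ b)
  | Leq => Leaf (a <= b)
  end.

Inductive prog :=
  | Prim of prim
  | Seq of prog & prog
  | Fork of prog & prog
  | If of prog & prog & prog
  | While of prog & prog.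

Definition dtrue (d : data) : bool := if d is Leaf 0 then false else true.

(* [run p d r t]: on input [d], program [p] halts with result [r] at cost     *)
(* [t]. The tests of [If] and [While] are evaluated on a copy of the current  *)
(* data, and [Fork] runs both branches on copies of its input.                *)
Inductive run : prog -> data -> data -> nat -> Prop :=
  | RunPrim o d :
      run (Prim o) d (prim_eval o d) (dsize d + dsize (prim_eval o d))
  | RunSeq p q d d1 d2 t1 t2 :
      run p d d1 t1 -> run q d1 d2 t2 -> run (Seq p q) d d2 (t1 + t2).+1
  | RunFork p q d a b t1 t2 :
      run p d a t1 -> run q d b t2 ->
      run (Fork p q) d (Pair a b) (dsize d + t1 + t2).+1
  | RunIf c p q d b r t1 t2 :
      run c d b t1 -> run (if dtrue b then p else q) d r t2 ->
      run (If c p q) d r (dsize d + t1 + t2).+1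
  | RunWhileStop c p d b t1 :
      run c d b t1 -> ~~ dtrue b ->
      run (While c p) d d (dsize d + t1).+1
  | RunWhileStep c p d b d1 r t1 t2 t3 :
      run c d b t1 -> dtrue b -> run p d d1 t2 -> run (While c p) d1 r t3 ->
      run (While c p) d r (dsize d + t1 + t2 + t3).+1.

Lemma run_det p d r1 t1 r2 t2 :
  run p d r1 t1 -> run p d r2 t2 -> r1 = r2 /\ t1 = t2.
Proof.
move=> H; elim: H r2 t2 => {p d r1 t1}.
- by move=> o d r2 t2 H; inversion H; subst.
- move=> p q d d1 d2 t1 t2 _ IH1 _ IH2 r t H; inversion H; subst.
  have [? ?] := IH1 _ _ ltac:(eassumption); subst.
  by have [? ?] := IH2 _ _ ltac:(eassumption); subst.
- move=> p q d a b t1 t2 _ IH1 _ IH2 r t H; inversion H; subst.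
  have [? ?] := IH1 _ _ ltac:(eassumption); subst.
  by have [? ?] := IH2 _ _ ltac:(eassumption); subst.
- move=> c p q d b r t1 t2 _ IH1 _ IH2 r' t H.
  inversion H as [| | |? ? ? ? ? ? ? ? Hc Hb| |]; subst.
  have [? ?] := IH1 _ _ Hc; subst.
  by have [? ?] := IH2 _ _ Hb; subst.
- move=> c p d b t1 _ IH1 nb r t H.
  inversion H as [| | | |? ? ? ? ? Hc|? ? ? ? ? ? ? ? ? Hc tb]; subst;
    have [? ?] := IH1 _ _ Hc; subst => //.
  by rewrite tb in nb.
- move=> c p d b d1 r t1 t2 t3 _ IH1 tb _ IH2 _ IH3 r' t H.
  inversion H as [| | | |? ? ? ? ? Hc nb|? ? ? ? ? ? ? ? ? Hc _ Hp Hw]; subst;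
    have [? ?] := IH1 _ _ Hc; subst.
    by rewrite tb in nb.
  have [? ?] := IH2 _ _ Hp; subst.
  by have [? ?] := IH3 _ _ Hw; subst.
Qed.

Local Open Scope ring_scope.

(* Some program halts on every instance in [dom] within time polynomial in    *)
(* the bit size of the encoded instance, with a result meeting [spec].        *)
Definition poly_time_solvable (I : Type) (dom : I -> Prop) (input : I -> data)
    (spec : I -> data -> Prop) : Prop :=
  exists (p : prog) (T : {poly nat}), forall i : I, dom i ->
    exists (r : data) (t : nat),
      [/\ run p (input i) r t, (t <= T.[dsize (input i)])%N & spec i r].

Definition dlist : seq data -> data := foldr Pair (Leaf 0).

(* [len] and [Dist] are only meaningful on [edges] and [demands]. *)
Record instance := Instance {
  nv : nat;
  edges : {set 'I_nv * 'I_nv};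
  len : 'I_nv * 'I_nv -> nat;
  demands : {set 'I_nv * 'I_nv};
  Dist : 'I_nv * 'I_nv -> nat;
  hopbound : nat
}.

Definition lengths_bounded (q : {poly nat}) (G : instance) : Prop :=
  forall e, e \in edges G -> (1 <= len e <= q.[nv G])%N.

Definition enc_weighted (n : nat) (A : {set 'I_n * 'I_n})
    (w : 'I_n * 'I_n -> nat) : data :=
  dlist [seq Pair (Pair (Leaf e.1) (Leaf e.2)) (Leaf (w e))
        | e : 'I_n * 'I_n <- enum A].

(* The vertices are listed explicitly, so that an encoding has size at least  *)
(* the number of vertices.                                                    *)
Definition enc_instance (G : instance) : data :=
  Pair (dlist [seq Leaf v | v : 'I_(nv G) <- enum 'I_(nv G)])
    (Pair (enc_weighted (edges G) (@len G))
       (Pair (enc_weighted (demands G) (@Dist G)) (Leaf (hopbound G)))).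

Section Hopset.
Variable G : instance.
Local Notation V := 'I_(nv G).

Definition is_path (a : rel V) (u v : V) (p : seq V) : bool :=
  [&& path a u p, last u p == v & uniq (u :: p)].

Definition path_edges (u : V) (p : seq V) : seq (V * V) := zip (u :: p) p.

Definition path_len (w : V * V -> nat) (u : V) (p : seq V) : nat :=
  (\sum_(e <- path_edges u p) w e)%N.

Definition G_rel : rel V := [rel u v | (u, v) \in edges G].

Definition path_of_len (u v : V) : pred nat :=
  [pred d | `[< exists2 p, is_path G_rel u v p & path_len (@len G) u p = d >]].

(* The distance in the graph; the value 0 given to unreachable pairs is never *)
(* used.                                                                      *)
Definition dG (e : V * V) : nat :=
  if pselect (exists d, path_of_len e.1 e.2 d) is left h then ex_minn h else 0%N.

Definition E_M : {set V * V} := [set e | connect G_rel e.1 e.2].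

Definition E_M_rel : rel V := [rel u v | (u, v) \in E_M].

Definition E_tilde : {set V * V} := E_M :\: edges G.

Definition allowed_path (s t : V) (p : seq V) : Prop :=
  [/\ is_path E_M_rel s t p, (size p <= hopbound G)%N
    & (path_len dG s p <= Dist (s, t))%N].

(* Vectors indexed by [E_M] are given as functions on all pairs, of which   *)
(* only the values on [E_M] matter.                                           *)
Definition Zset (R : realType) (s t : V) (z : V * V -> R) : Prop :=
  (forall e, e \in E_M -> 0 <= z e <= 1) /\
  (forall p, allowed_path s t p -> 1 <= \sum_(e <- path_edges s p) z e).

Definition lp_feasible (R : realType) (x : V * V -> R) : Prop :=
  (forall s t, (s, t) \in demands G -> forall z : V * V -> R, Zset s t z ->
     1 <= \sum_(e in E_M) z e * x e) /\
  (forall e, e \in E_M -> 0 <= x e).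

Definition lp_objective (R : realType) (x : V * V -> R) : R :=
  \sum_(e in E_tilde) x e.

Definition lp_opt (R : realType) : R :=
  inf [set lp_objective x | x in [set x | @lp_feasible R x]]%classic.

(* The table of the fractions [num e / den e], row by row. *)
Definition enc_fractions (num den : V * V -> nat) : data :=
  dlist [seq dlist [seq Pair (Leaf (num (u, v))) (Leaf (den (u, v)))
                   | v <- enum 'I_(nv G)] | u <- enum 'I_(nv G)].

Definition encodes_vector (R : realType) (r : data) (x : V * V -> R) : Prop :=
  exists num den : V * V -> nat,
    [/\ forall e, (0 < den e)%N, r = enc_fractions num den
      & forall e, x e = (num e)%:R / (den e)%:R].

(* Nothing is required of the output if the linear program is infeasible.     *)
Definition approx_solution (R : realType) (eps : R) (r : data) : Prop :=
  (exists y : V * V -> R, lp_feasible y) ->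
  exists x : V * V -> R,
    [/\ encodes_vector r x, lp_feasible x
      & lp_objective x <= (1 + eps) * lp_opt R].

End Hopset.

(* Main.v *)
(* The linear program asks for capacities [x], free on [E], that carry a unit *)
(* flow on the allowed paths of each demand separately. Give every demand [d] *)
(* and pair [e] a virtual queue [Q d e]. In each round, [d] routes one unit   *)
(* along an allowed path minimizing the sum of [Q d e + 1] over the edges     *)
(* outside [E], and [e] serves all its queues by one unit if their total      *)
(* exceeds a threshold [V]. The drift of the sum of the [Q d e ^ 2] plus [V]  *)
(* times the number of services is bounded, for every feasible [y], in terms  *)
(* of the objective of [y]: the cheapest path of [d] costs at most the sum of *)
(* [(Q d e + 1) * min (y e) 1], because rescaling the weights gives a point   *)
(* of the polytope of cuts against which [y] is tested. Hence after           *)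
(* polynomially many rounds the average flows, maximized over [d], are almost *)
(* optimal. The optimum is 0 or at least 1, so an additive error suffices; if *)
(* it is 0, all demands are routed inside [E] and the output costs 0 as well. *)
(* Lengths being polynomial, the paths are found by dynamic programming over  *)
(* vertices and lengths.                                                      *)

Require Import Defs.
From mathcomp Require Import all_boot all_order all_algebra.
From mathcomp Require Import all_classical all_reals.
From mathcomp Require Import zify ring lra.
Import Order.TTheory GRing.Theory Num.Theory.
Set Implicit Arguments.
Unset Strict Implicit.
Unset Printing Implicit Defensive.

(** * Polynomial-time maps *)

Section HornerNat.
Implicit Types P S : {poly nat}.

Lemma horner_nat_mono P m n : m <= n -> P.[m]%R <= P.[n]%R.
Proof.
move=> lemn; elim/poly_ind: P => [|P c IH]; first by rewrite !horner0.
by rewrite !hornerMXaddC leq_add2r; apply: leq_mul.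
Qed.

Lemma horner_nat_add P S n : (P + S)%R.[n]%R = P.[n]%R + S.[n]%R.
Proof. exact: hornerD. Qed.

Lemma horner_nat_mul P S n : (P * S)%R.[n]%R = P.[n]%R * S.[n]%R.
Proof. exact: hornerM. Qed.

Lemma horner_nat_comp P S n : (P \Po S)%R.[n]%R = P.[S.[n]]%R.
Proof. exact: horner_comp. Qed.
End HornerNat.

Section Bounded.
Variables (I : Type) (x : I -> data).
Implicit Types f g : I -> nat.

Definition bd f := exists P : {poly nat}, forall i, f i <= (P.[dsize (x i)])%R.

Lemma bd_le f g : (forall i, f i <= g i) -> bd g -> bd f.
Proof. by move=> le [P leP]; exists P => i; apply: leq_trans (le i) (leP i). Qed.

Lemma bd_const c : bd (fun=> c).
Proof. by exists (c%:P)%R => i; rewrite hornerC. Qed.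

Lemma bd_size : bd (fun i => dsize (x i)).
Proof. by exists ('X)%R => i; rewrite hornerX. Qed.

Lemma bd_add f g : bd f -> bd g -> bd (fun i => f i + g i).
Proof.
move=> [P hP] [S hS]; exists (P + S)%R => i.
by rewrite horner_nat_add leq_add.
Qed.

Lemma bd_mul f g : bd f -> bd g -> bd (fun i => f i * g i).
Proof.
move=> [P hP] [S hS]; exists (P * S)%R => i.
by rewrite horner_nat_mul leq_mul.
Qed.

Lemma bd_S f : bd f -> bd (fun i => (f i).+1).
Proof.
move=> h; apply: bd_le (bd_add h (bd_const 1)) => i; by rewrite addn1.
Qed.

Lemma bd_horner (P : {poly nat}) f : bd f -> bd (fun i => (P.[f i])%R).
Proof.
move=> [S hS]; exists (P \Po S)%R => i.
by rewrite horner_nat_comp; apply: horner_nat_mono.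
Qed.

End Bounded.

Lemma bd_comp I (x y : I -> data) f :
  bd y f -> bd x (fun i => dsize (y i)) -> bd x f.
Proof.
move=> [P hP] h; apply: bd_le (bd_horner P h); exact: hP.
Qed.

Lemma dsize_gt0 d : 0 < dsize d. Proof. by case: d. Qed.

Lemma run_size p d r t : run p d r t -> (dsize r <= t) && (dsize d <= t).
Proof. by elim=> {p d r t} => * /=; lia. Qed.

Definition pt I (x y : I -> data) := exists p (t : I -> nat),
  (forall i, run p (x i) (y i) (t i)) /\ bd x t.

Lemma pt_size I (x y : I -> data) : pt x y -> bd x (fun i => dsize (y i)).
Proof.
move=> [p [t [r h]]]; apply: bd_le h => i.
by have /andP[] := run_size (r i).
Qed.

Lemma pt_ext I (x x' y y' : I -> data) :
  x =1 x' -> y =1 y' -> pt x y -> pt x' y'.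
Proof.
move=> ex ey [p [t [r [P h]]]]; exists p, t; split=> [i|]; first by rewrite -ex -ey.
by exists P => i; rewrite -ex.
Qed.

Lemma pt_reindex I J (h : J -> I) (x y : I -> data) :
  pt x y -> pt (fun j => x (h j)) (fun j => y (h j)).
Proof. by move=> [p [t [r [P b]]]]; exists p, (fun j => t (h j)); split=> //; exists P. Qed.

Lemma pt_seq I (x y z : I -> data) : pt x y -> pt y z -> pt x z.
Proof.
move=> xy [q [t2 [r2 b2]]]; have by_ := pt_size xy.
case: xy => p [t1 [r1 b1]]; exists (Seq p q), (fun i => (t1 i + t2 i).+1).
split=> [i|]; first exact: RunSeq.
exact: bd_S (bd_add b1 (bd_comp b2 by_)).
Qed.

Lemma pt_fork I (x y z : I -> data) :
  pt x y -> pt x z -> pt x (fun i => Pair (y i) (z i)).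
Proof.
move=> [p [t1 [r1 b1]]] [q [t2 [r2 b2]]].
exists (Fork p q), (fun i => (dsize (x i) + t1 i + t2 i).+1).
split=> [i|]; first exact: RunFork.
exact: bd_S (bd_add (bd_add (bd_size x) b1) b2).
Qed.

Lemma pt_if I (x : I -> data) (c : I -> bool) (y z : I -> data) :
  pt x (fun i => Leaf (c i)) -> pt x y -> pt x z ->
  pt x (fun i => if c i then y i else z i).
Proof.
move=> [o [t0 [r0 b0]]] [p [t1 [r1 b1]]] [q [t2 [r2 b2]]].
exists (If o p q), (fun i => (dsize (x i) + t0 i + if c i then t1 i else t2 i).+1).
split=> [i|].
  by apply: RunIf (r0 i) _; case: (c i) => /=; [apply: r1|apply: r2].
apply: bd_S; apply: bd_add (bd_add (bd_size x) b0) _.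
by apply: bd_le (bd_add b1 b2) => i; case: ifP; rewrite ?leq_addr ?leq_addl.
Qed.

Definition nsz n := dsize (Leaf n).

Lemma nsz_le m n : m <= n -> nsz m <= nsz n.
Proof. by move=> h; rewrite /nsz /= ltnS leq_up_log. Qed.

Lemma nszP n k : n < 2 ^ k -> nsz n <= k.+1.
Proof. by move=> h; rewrite /nsz /= ltnS up_log_min. Qed.

Lemma lt_nsz n : n < 2 ^ (nsz n).-1.
Proof. by rewrite /nsz /=; exact: up_logP. Qed.

Lemma nsz_gt0 n : 0 < nsz n. Proof. by []. Qed.

Lemma nsz_linear n : nsz n <= n.+2.
Proof. by apply: nszP; apply: leq_trans (ltn_expl n (isT : 1 < 2)) _; rewrite leq_exp2l. Qed.

Lemma nsz_add a b : nsz (a + b) <= nsz a + nsz b.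
Proof.
have := lt_nsz a; have := lt_nsz b; have := nsz_gt0 a; have := nsz_gt0 b.
move: (nsz a) (nsz b) => [|i] [|j] //= _ _ hb ha; rewrite addSn addnS.
apply: leq_trans (nszP _) (leqnSn _); rewrite expnD; nia.
Qed.

Lemma nsz_mul a b : nsz (a * b) <= nsz a + nsz b.
Proof.
have := lt_nsz a; have := lt_nsz b; have := nsz_gt0 a; have := nsz_gt0 b.
move: (nsz a) (nsz b) => [|i] [|j] //= _ _ hb ha; rewrite addSn addnS.
apply: leq_trans (nszP _) (leqnSn _); rewrite expnD; nia.
Qed.

Lemma dsize_dfst d : dsize (dfst d) <= dsize d.
Proof. by case: d => [n|a b] /=; rewrite ?up_log1; lia. Qed.

Lemma dsize_dsnd d : dsize (dsnd d) <= dsize d.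
Proof. by case: d => [n|a b] /=; rewrite ?up_log1; lia. Qed.

Lemma nsz_dnat d : nsz (dnat d) <= dsize d.
Proof. by case: d => [n|a b] //=; have := dsize_gt0 a; rewrite /nsz /= up_log1; lia. Qed.

Lemma pt_prim I (x : I -> data) o : pt x (fun i => prim_eval o (x i)).
Proof.
exists (Prim o), (fun i => dsize (x i) + dsize (prim_eval o (x i))).
split=> [i|]; first exact: RunPrim.
pose k := if o is Const k then nsz k else 0.
apply: bd_le (bd_add (bd_size x) (bd_add (bd_add (bd_size x) (bd_size x)) (bd_const x k.+2))).
move=> i; rewrite leq_add2l.
have h1 := leq_trans (nsz_dnat _) (dsize_dfst (x i)).
have h2 := leq_trans (nsz_dnat _) (dsize_dsnd (x i)).
have u1 : up_log 2 1 = 0 by []; have u2 : up_log 2 2 = 1 by [].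
rewrite {}/k; case: o => [|k||||||||] /=.
- lia.
- by rewrite /nsz /=; lia.
- have := dsize_dfst (x i); lia.
- have := dsize_dsnd (x i); lia.
- by case: (x i) => * /=; lia.
- have := nsz_add (dnat (dfst (x i))) (dnat (dsnd (x i))); rewrite /nsz /= in h1 h2 *; lia.
- have := nsz_le (leq_subr (dnat (dsnd (x i))) (dnat (dfst (x i)))); rewrite /nsz /= in h1 h2 *; lia.
- have := nsz_mul (dnat (dfst (x i))) (dnat (dsnd (x i))); rewrite /nsz /= in h1 h2 *; lia.
- have := nsz_le (leq_div (dnat (dfst (x i))) (dnat (dsnd (x i)))); rewrite /nsz /= in h1 h2 *; lia.
- by case: (dnat _ <= dnat _) => /=; lia.
Qed.

Lemma run_while o p (st b : nat -> data) (tc table_at : nat -> nat) (B N : nat) :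
  (forall j, j <= N -> run o (st j) (b j) (tc j) /\ dtrue (b j) = (j < N)) ->
  (forall j, j < N -> run p (st j) (st j.+1) (table_at j)) ->
  (forall j, j <= N -> dsize (st j) + tc j <= B) ->
  (forall j, j < N -> table_at j <= B) ->
  exists2 t, run (While o p) (st 0) (st N) t & t <= N.+1 * (2 * B).+1.
Proof.
elim: N st b tc table_at => [|N IH] st b tc table_at ho hp hB hb.
  have [r e] := ho 0 isT; exists (dsize (st 0) + tc 0).+1.
    by apply: RunWhileStop r _; rewrite e.
  by have := hB 0 isT; lia.
have [||||t r le] := IH (fun j => st j.+1) (fun j => b j.+1) (fun j => tc j.+1) (fun j => table_at j.+1).
- by move=> j lej; have [? ?] := ho j.+1 lej; split.
- by move=> j ltj; apply: hp.
- by move=> j lej; apply: hB.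
- by move=> j ltj; apply: hb.
have [r0 e] := ho 0 isT.
exists (dsize (st 0) + tc 0 + table_at 0 + t).+1.
  by apply: RunWhileStep r0 _ (hp 0 isT) r; rewrite e.
by have := hB 0 isT; have := hb 0 isT; lia.
Qed.

(* The test and the body are only required to behave well on the states that  *)
(* are reached, which are given as instances of arbitrary index types.        *)
Lemma pt_while I J K (st : I -> nat -> data) (N : I -> nat)
    (xo yo : J -> data) (xb yb : K -> data) (B : I -> nat) :
  pt xo yo -> pt xb yb ->
  (forall i j, j <= N i -> exists2 k, xo k = st i j & dtrue (yo k) = (j < N i)) ->
  (forall i j, j < N i -> exists2 k, xb k = st i j & yb k = st i j.+1) ->
  bd (st^~ 0) N -> bd (st^~ 0) B ->
  (forall i j, j <= N i -> dsize (st i j) <= B i) ->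
  pt (st^~ 0) (fun i => st i (N i)).
Proof.
move=> [o [to [ro [Po bo]]]] [p [tp [rp [Pp bp]]]] ho hp bN bB hB.
pose C i := B i + Po.[B i]%R + Pp.[B i]%R.
have run_i i : exists t, run (While o p) (st i 0) (st i (N i)) t /\
    t <= (N i).+1 * (2 * C i).+1.
  have so (j : 'I_(N i).+1) : exists bt : data * nat,
      [/\ run o (st i j) bt.1 bt.2, dtrue bt.1 = (j < N i) & bt.2 <= Po.[B i]%R].
    have [k e1 e2] := ho i j (ltn_ord j); exists (yo k, to k); split=> //=.
      by rewrite -e1.
    apply: leq_trans (bo k) _; apply: horner_nat_mono; rewrite e1.
    by apply: hB; rewrite -ltnS.
  have sp (j : 'I_(N i)) : exists t, run p (st i j) (st i j.+1) t /\ t <= Pp.[B i]%R.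
    have [k e1 e2] := hp i j (ltn_ord j); exists (tp k); split=> //=.
      by rewrite -e1 -e2.
    apply: leq_trans (bp k) _; apply: horner_nat_mono; rewrite e1.
    by apply: hB; apply: ltnW.
  have [fo fop] := boolp.choice so; have [fp fpp] := boolp.choice sp.
  pose ord m n (h : 0 < n) := insubd (Ordinal h) m : 'I_n.
  have vo j (h : 0 < (N i).+1) : j <= N i -> ord j _ h = j :> nat.
    by move=> lej; rewrite /ord val_insubd ltnS lej.
  have [||||t r le] := @run_while o p (st i) (fun j => (fo (ord j _ (ltn0Sn _))).1)
    (fun j => (fo (ord j _ (ltn0Sn _))).2)
    (fun j => if insub j is Some k then fp k else 0) (C i) (N i).
  - by move=> j lej; have [] := fop (ord j _ (ltn0Sn _)); rewrite vo.
  - move=> j ltj; rewrite insubT; exact: (fpp (Ordinal ltj)).1.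
  - move=> j lej; have [_ _ h] := fop (ord j _ (ltn0Sn _)).
    by have := hB i j lej; rewrite /C; lia.
  - move=> j ltj; rewrite insubT; apply: leq_trans (fpp (Ordinal ltj)).2 _.
    by rewrite /C leq_addl.
  by exists t.
have [t tp'] := boolp.choice run_i; exists (While o p), t.
split=> [i|]; first by have [] := tp' i.
apply: (@bd_le _ _ _ (fun i => (N i).+1 * (2 * C i).+1)) => [i|]; first by have [] := tp' i.
apply: bd_mul (bd_S bN) (bd_S (bd_mul (bd_const _ 2) _)).
by apply: bd_add; [apply: bd_add => //|]; apply: bd_horner.
Qed.

Class Enc (A : Type) := enc : A -> data.
#[export] Instance Enc_nat : Enc nat := Leaf.
#[export] Instance Enc_bool : Enc bool := fun b => Leaf b.
#[export] Instance Enc_prod A B (EA : Enc A) (EB : Enc B) : Enc (A * B) :=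
  fun x => Pair (EA x.1) (EB x.2).
#[export] Instance Enc_seq A (EA : Enc A) : Enc (seq A) := fun s => dlist (map EA s).

Definition PT A B {EA : Enc A} {EB : Enc B} (f : A -> B) :=
  pt (@enc A EA) (fun a => @enc B EB (f a)).

Section Composition.
Context {A B C D : Type} {EA : Enc A} {EB : Enc B} {EC : Enc C} {ED : Enc D}.

Lemma PT_ext (f g : A -> B) : f =1 g -> PT f -> PT g.
Proof. by move=> e; apply: pt_ext => // a; rewrite e. Qed.

Lemma PT_id : PT (fun a : A => a).
Proof. exact: (pt_prim enc Id). Qed.

Lemma PT_comp (g : B -> C) (f : A -> B) : PT g -> PT f -> PT (fun a => g (f a)).
Proof. by move=> hg hf; apply: pt_seq hf (pt_reindex f hg). Qed.

Lemma PT_pair (f : A -> B) (g : A -> C) : PT f -> PT g -> PT (fun a => (f a, g a)).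
Proof. exact: pt_fork. Qed.

End Composition.

Section Projections.
Context {A B C D : Type} {EA : Enc A} {EB : Enc B} {EC : Enc C} {ED : Enc D}.

Lemma PT_comp2 (h : B -> C -> D) (f : A -> B) (g : A -> C) :
  PT (fun x : B * C => h x.1 x.2) -> PT f -> PT g -> PT (fun a => h (f a) (g a)).
Proof. by move=> hh hf hg; apply: (PT_comp hh (PT_pair hf hg)). Qed.

Lemma PT_fst (f : A -> B * C) : PT f -> PT (fun a => (f a).1).
Proof. by move=> hf; apply: pt_seq hf (pt_prim _ Fst). Qed.

Lemma PT_snd (f : A -> B * C) : PT f -> PT (fun a => (f a).2).
Proof. by move=> hf; apply: pt_seq hf (pt_prim _ Snd). Qed.

Lemma PT_nat (n : nat) : PT (fun _ : A => n).
Proof. exact (pt_prim (@enc A EA) (Const n)). Qed.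

Lemma PT_bool (b : bool) : PT (fun _ : A => b).
Proof. exact (pt_prim (@enc A EA) (Const b)). Qed.

Lemma PT_nil : PT (fun _ : A => [::] : seq B).
Proof. exact (pt_prim (@enc A EA) (Const 0)). Qed.

Lemma PT_cons (f : A -> B) (g : A -> seq B) : PT f -> PT g -> PT (fun a => f a :: g a).
Proof. exact: pt_fork. Qed.

Lemma PT_if (c : A -> bool) (f g : A -> B) :
  PT c -> PT f -> PT g -> PT (fun a => if c a then f a else g a).
Proof.
move=> hc hf hg; apply: (pt_ext _ _ (pt_if hc hf hg)) => // a; by case: (c a).
Qed.

End Projections.

Section Lists_and_numbers.
Context {A B C D : Type} {EA : Enc A} {EB : Enc B} {EC : Enc C} {ED : Enc D}.

Lemma PT_nilp (f : A -> seq B) : PT f -> PT (fun a => nilp (f a)).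
Proof.
move=> hf; have h : PT (fun a => ~~ nilp (f a)).
  apply: (pt_ext _ _ (pt_seq hf (pt_prim _ IsPair))) => // a.
  by rewrite /enc /Enc_seq; case: (f a).
by apply: (PT_ext _ (PT_if h (PT_bool false) (PT_bool true))) => a; case: nilp.
Qed.

Lemma PT_head (d : B) (f : A -> seq B) :
  PT (fun _ : A => d) -> PT f -> PT (fun a => head d (f a)).
Proof.
move=> hd hf.
apply: (pt_ext _ _ (pt_if (PT_nilp hf) hd (pt_seq hf (pt_prim _ Fst)))) => // a.
by rewrite /enc /Enc_seq; case: (f a).
Qed.

Lemma PT_bin o (op : nat -> nat -> nat) (f g : A -> nat) :
  (forall m n, prim_eval o (Pair (Leaf m) (Leaf n)) = Leaf (op m n)) ->
  PT f -> PT g -> PT (fun a => op (f a) (g a)).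
Proof.
move=> e hf hg; apply: (pt_ext _ _ (pt_seq (pt_fork hf hg) (pt_prim _ o))) => a; [by []|exact: e].
Qed.

Lemma PT_add (f g : A -> nat) : PT f -> PT g -> PT (fun a => f a + g a).
Proof. exact: (@PT_bin Add). Qed.
Lemma PT_sub (f g : A -> nat) : PT f -> PT g -> PT (fun a => f a - g a).
Proof. exact: (@PT_bin Minus). Qed.
Lemma PT_mul (f g : A -> nat) : PT f -> PT g -> PT (fun a => f a * g a).
Proof. exact: (@PT_bin Mul). Qed.
Lemma PT_leq (f g : A -> nat) : PT f -> PT g -> PT (fun a => f a <= g a).
Proof. exact: (@PT_bin Leq leq). Qed.
End Lists_and_numbers.

Section Booleans.
Context {A B C D : Type} {EA : Enc A} {EB : Enc B} {EC : Enc C} {ED : Enc D}.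

Lemma PT_S (f : A -> nat) : PT f -> PT (fun a => (f a).+1).
Proof. by move=> h; apply: (PT_ext _ (PT_add h (PT_nat 1))) => a; rewrite addn1. Qed.

Lemma PT_nat_of_bool (f : A -> bool) : PT f -> PT (fun a => f a : nat).
Proof. by []. Qed.

Lemma PT_neg (f : A -> bool) : PT f -> PT (fun a => ~~ f a).
Proof. by move=> h; apply: (PT_if h (PT_bool false) (PT_bool true)). Qed.
Lemma PT_and (f g : A -> bool) : PT f -> PT g -> PT (fun a => f a && g a).
Proof. by move=> hf hg; apply: (PT_if hf hg (PT_bool false)). Qed.
Lemma PT_or (f g : A -> bool) : PT f -> PT g -> PT (fun a => f a || g a).
Proof. by move=> hf hg; apply: (PT_if hf (PT_bool true) hg). Qed.

Lemma PT_bd (f : A -> B) : PT f -> bd (@enc A EA) (fun a => dsize (enc (f a))).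
Proof. exact: pt_size. Qed.

End Booleans.

Lemma PT_minn A {EA : Enc A} (f g : A -> nat) : PT f -> PT g -> PT (fun a => minn (f a) (g a)).
Proof.
by move=> hf hg; rewrite /minn; apply: PT_if => //; apply: PT_leq => //; apply: PT_S.
Qed.
Lemma PT_maxn A {EA : Enc A} (f g : A -> nat) : PT f -> PT g -> PT (fun a => maxn (f a) (g a)).
Proof.
by move=> hf hg; rewrite /maxn; apply: PT_if => //; apply: PT_leq => //; apply: PT_S.
Qed.

(* Matches on syntax only: plain [apply] with these lemmas can make           *)
(* higher-order unification diverge.                                          *)
Ltac pt_step :=
  lazymatch goal with
  | |- PT (fun a => a) => refine PT_id
  | |- PT fst => refine (PT_fst PT_id)
  | |- PT snd => refine (PT_snd PT_id)
  | |- PT (fun a => fst (@?f a)) => refine (@PT_fst _ _ _ _ _ _ f _)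
  | |- PT (fun a => snd (@?f a)) => refine (@PT_snd _ _ _ _ _ _ f _)
  | |- PT (fun a => (@?f a, @?g a)) => refine (@PT_pair _ _ _ _ _ _ f g _ _)
  | |- PT (fun a => (@?f a) :: (@?g a)) => refine (@PT_cons _ _ _ _ f g _ _)
  | |- PT (fun a => match @?c a with true => @?f a | false => @?g a end) => refine (@PT_if _ _ _ _ c f g _ _ _)
  | |- PT (fun a => addn (@?f a) (@?g a)) => refine (@PT_add _ _ f g _ _)
  | |- PT (fun a => subn (@?f a) (@?g a)) => refine (@PT_sub _ _ f g _ _)
  | |- PT (fun a => muln (@?f a) (@?g a)) => refine (@PT_mul _ _ f g _ _)
  | |- PT (fun a => leq (@?f a) (@?g a)) => refine (@PT_leq _ _ f g _ _)
  | |- PT (fun a => S (@?f a)) => refine (@PT_S _ _ f _)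
  | |- PT (fun a => minn (@?f a) (@?g a)) => refine (@PT_minn _ _ f g _ _)
  | |- PT (fun a => maxn (@?f a) (@?g a)) => refine (@PT_maxn _ _ f g _ _)
  | |- PT (fun a => negb (@?f a)) => refine (@PT_neg _ _ f _)
  | |- PT (fun a => andb (@?f a) (@?g a)) => refine (@PT_and _ _ f g _ _)
  | |- PT (fun a => orb (@?f a) (@?g a)) => refine (@PT_or _ _ f g _ _)
  | |- PT (fun a => nat_of_bool (@?f a)) => refine (@PT_nat_of_bool _ _ f _)
  | |- PT (fun a => nilp (@?f a)) => refine (@PT_nilp _ _ _ _ f _)
  | |- @PT _ nat _ _ (fun a => ?n) => refine (PT_nat n)
  | |- @PT _ bool _ _ (fun a => ?b) => refine (PT_bool b)
  | |- PT (fun a => [::]) => refine PT_nil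
  end; cbv beta.

Ltac pt_app1 H :=
  lazymatch goal with
  | |- PT (fun a => ?h (@?f a)) =>
      refine (@PT_comp _ _ _ _ _ _ h f H _); cbv beta
  end.

Ltac pt_app2 H :=
  lazymatch goal with
  | |- PT (fun a => ?h (@?f a) (@?g a)) =>
      refine (@PT_comp2 _ _ _ _ _ _ _ _ h f g H _ _); cbv beta
  end.

Ltac pt_steps := cbv beta; repeat pt_step.

Definition PTeq (A : eqType) {EA : Enc A} := PT (fun x : A * A => x.1 == x.2).

Arguments PTeq A {EA}.

Lemma PTeq_nat : PTeq nat.
Proof.
apply: (@PT_ext _ _ _ _ (fun x => (x.1 <= x.2) && (x.2 <= x.1))) => [x|].
  by rewrite -eqn_leq.
by pt_steps.
Qed.

Lemma PT_eq A (B : eqType) {EA : Enc A} {EB : Enc B} (f g : A -> B) :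
  PTeq B -> PT f -> PT g -> PT (fun a => f a == g a).
Proof. by move=> h hf hg; apply: (PT_comp h (PT_pair hf hg)). Qed.

Lemma PTeq_prod (A B : eqType) {EA : Enc A} {EB : Enc B} :
  PTeq A -> PTeq B -> PTeq (A * B)%type.
Proof.
move=> hA hB; apply: (@PT_ext _ _ _ _ (fun x => (x.1.1 == x.2.1) && (x.1.2 == x.2.2))) => //.
by apply: PT_and; apply: PT_eq => //; pt_steps.
Qed.

(** * Polynomial-time list processing *)

Ltac pt_eqs := first [exact PTeq_nat | apply: PTeq_prod; pt_eqs].

Notation esize x := (dsize (enc x)).

Section Sizes.
Context {A B : Type} {EA : Enc A} {EB : Enc B}.

Lemma esz_pair (a : A) (b : B) : esize (a, b) = (esize a + esize b).+1.
Proof. by []. Qed.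
Lemma esz_nil : esize ([::] : seq A) = 1.
Proof. by rewrite /= up_log1. Qed.
Lemma esz_cons (a : A) s : esize (a :: s) = (esize a + esize s).+1.
Proof. by []. Qed.
Lemma esz_seq_gt0 (s : seq A) : 0 < esize s.
Proof. exact: dsize_gt0. Qed.
Lemma esz_cat (s t : seq A) : esize (s ++ t) <= esize s + esize t.
Proof.
elim: s => [|a s IH]; first by rewrite leq_addl.
by rewrite cat_cons !esz_cons; lia.
Qed.
Lemma esz_rcons (s : seq A) a : esize (rcons s a) = (esize a + esize s).+1.
Proof. by elim: s => [|b s IH] //; rewrite rcons_cons !esz_cons IH; lia. Qed.
Lemma esz_rev (s : seq A) : esize (rev s) = esize s.
Proof. by elim: s => [|a s IH] //; rewrite rev_cons esz_rcons IH. Qed.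
Lemma esz_take j (s : seq A) : esize (take j s) <= esize s.
Proof.
elim: s j => [|a s IH] [|j] //.
by rewrite take_cons !esz_cons; have := IH j; lia.
Qed.
Lemma size_esz (s : seq A) : size s <= esize s.
Proof. by elim: s => [|a s IH] //; rewrite esz_cons /=; lia. Qed.
End Sizes.

Lemma esz_seq_all (A : eqType) (EA : Enc A) (s : seq A) M :
  {in s, forall a, esize a <= M} -> esize s <= (size s * M.+1).+1.
Proof.
elim: s => [|a s IH] h; first by rewrite esz_nil.
rewrite esz_cons /=; have := h a (mem_head _ _).
have : esize s <= (size s * M.+1).+1 by apply: IH => b bs; apply: h; rewrite inE bs orbT.
lia.
Qed.

Lemma esz_mem (A : eqType) (EA : Enc A) (s : seq A) a : a \in s -> esize a <= esize s.
Proof.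
elim: s => // b s IH; rewrite inE esz_cons => /orP[/eqP->|/IH]; lia.
Qed.

Section Folds.
Context {A B C : Type} {EA : Enc A} {EB : Enc B} {EC : Enc C}.

Lemma PT_foldl (f : A -> C -> B -> C) (c0 : A -> C) (l : A -> seq B) (M : A -> nat) :
  PT (fun x : A * (C * B) => f x.1 x.2.1 x.2.2) -> PT c0 -> PT l ->
  bd (@enc A EA) M ->
  (forall a j, j <= size (l a) -> esize (foldl (f a) (c0 a) (take j (l a))) <= M a) ->
  PT (fun a => foldl (f a) (c0 a) (l a)).
Proof.
move=> hf hc hl bM hM.
pose st a j := Pair (EA a) (Pair (Enc_seq EB (drop j (l a))) (EC (foldl (f a) (c0 a) (take j (l a))))).
pose J := (A * (seq B * C))%type.
have t0 : pt (@enc J _) (fun y : J => Leaf (~~ nilp y.2.1)).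
  by apply: PT_neg; apply: PT_nilp; pt_steps.
pose K := ((A * (C * B)) * seq B)%type.
pose xb (k : K) := Enc_prod EA (Enc_prod (Enc_seq EB) EC) (k.1.1, (k.1.2.2 :: k.2, k.1.2.1)).
pose yb (k : K) := Enc_prod EA (Enc_prod (Enc_seq EB) EC) (k.1.1, (k.2, f k.1.1 k.1.2.1 k.1.2.2)).
have t1 : pt xb yb.
  have px0 : pt xb xb by exact: (pt_prim xb Id).
  have px (z w : K -> data) o : pt xb z -> (forall k, prim_eval o (z k) = w k) -> pt xb w.
    by move=> hz e; apply: pt_ext (pt_seq hz (pt_prim z o)).
  have pa : pt xb (fun k => enc k.1.1) by apply: (px _ _ Fst px0).
  have p2 : pt xb (fun k => enc (k.1.2.2 :: k.2, k.1.2.1)) by apply: (px _ _ Snd px0).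
  have pl : pt xb (fun k => enc (k.1.2.2 :: k.2)) by apply: (px _ _ Fst p2).
  have pc : pt xb (fun k => enc k.1.2.1) by apply: (px _ _ Snd p2).
  have pb : pt xb (fun k => enc k.1.2.2) by apply: (px _ _ Fst pl).
  have pl' : pt xb (fun k => enc k.2) by apply: (px _ _ Snd pl).
  have pf := pt_seq (pt_fork pa (pt_fork pc pb)) (pt_reindex fst hf).
  exact: pt_fork pa (pt_fork pl' pf).
have st0 : pt (@enc A EA) (st^~ 0).
  have h : PT (fun a => (a, (l a, c0 a))) by pt_steps.
  by apply: (pt_ext _ _ h) => // a; rewrite /st drop0 take0.
have bl : bd (st^~ 0) (fun a => esize (l a)).
  by apply: bd_le (bd_size _) => a; rewrite /st /enc drop0 /=; lia.
have ba : bd (st^~ 0) (fun a => esize a).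
  by apply: bd_le (bd_size _) => a; rewrite /st /enc /=; lia.
have bM' : bd (st^~ 0) M by apply: bd_comp bM ba.
have hw : pt (st^~ 0) (fun a => st a (size (l a))).
  apply: (pt_while (N := fun a => size (l a)) (B := fun a => (esize a + (esize (l a) + M a).+1).+1) t0 t1).
  - move=> a j lej; exists (a, (drop j (l a), foldl (f a) (c0 a) (take j (l a)))) => //=.
    by rewrite /nilp size_drop subn_eq0 -ltnNge; case: (_ < _).
  - move=> a j ltj; case e: (drop j (l a)) => [|b s].
      by move: (congr1 size e); rewrite size_drop /= => /eqP; rewrite subn_eq0 leqNgt ltj.
    exists ((a, (foldl (f a) (c0 a) (take j (l a)), b)), s); rewrite /xb /st /yb /= ?e //.
    have -> : drop j.+1 (l a) = s by rewrite -add1n -drop_drop e /= drop0.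
    have -> : take j.+1 (l a) = rcons (take j (l a)) b.
      by rewrite -addn1 takeD e /= take0 cats1.
    by rewrite -cats1 foldl_cat.
  - by apply: bd_le bl => a; apply: size_esz.
  - by apply: bd_S (bd_add ba (bd_S (bd_add bl bM'))).
  - move=> a j lej; rewrite /st /=; have := hM a j lej.
    have : esize (drop j (l a)) <= esize (l a).
      elim: (l a) j {lej} => [|b s IH] [|j] //.
      by rewrite drop_cons esz_cons; have := IH j; lia.
    by rewrite /enc /=; lia.
have := pt_seq (pt_seq st0 hw) (pt_seq (pt_prim _ Snd) (pt_prim _ Snd)).
by apply: pt_ext => // a; rewrite /st /= take_size.
Qed.

Lemma PT_iter (f : A -> C -> C) (c0 : A -> C) (n : A -> nat) (M : A -> nat) :
  PT (fun x : A * C => f x.1 x.2) -> PT c0 -> PT n ->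
  bd (@enc A EA) n -> bd (@enc A EA) M ->
  (forall a j, j <= n a -> esize (iter j (f a) (c0 a)) <= M a) ->
  PT (fun a => iter (n a) (f a) (c0 a)).
Proof.
move=> hf hc hn bn bM hM.
pose st a j := Enc_prod EA (Enc_prod Enc_nat EC) (a, (n a - j, iter j (f a) (c0 a))).
pose J := (A * (nat * C))%type.
have t0 : PT (fun y : J => y.2.1) by pt_steps.
pose yb (y : J) := (y.1, (y.2.1 - 1, f y.1 y.2.2)).
have t1 : PT yb.
  by rewrite /yb; pt_steps; pt_app2 hf; pt_steps.
have st0 : pt (@enc A EA) (st^~ 0).
  have h : PT (fun a => (a, (n a - 0, c0 a))) by pt_steps.
  exact: h.
have ba : bd (st^~ 0) (fun a => esize a).
  by apply: bd_le (bd_size _) => a; rewrite /st /enc /=; lia.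
have hw : pt (st^~ 0) (fun a => st a (n a)).
  apply: (pt_while (N := n) (B := fun a => (esize a + ((n a).+2 + M a).+1).+1) t0 t1).
  - move=> a j lej; exists (a, (n a - j, iter j (f a) (c0 a))) => //=.
    by rewrite -subn_gt0 /enc /Enc_nat; case: (n a - j).
  - move=> a j ltj; exists (a, (n a - j, iter j (f a) (c0 a))) => //=.
    by rewrite /yb /= subn1 -subnS.
  - exact: bd_comp bn ba.
  - by apply: bd_S (bd_add ba (bd_S (bd_add (bd_S (bd_S (bd_comp bn ba))) (bd_comp bM ba)))).
  - move=> a j lej; rewrite /st !esz_pair; have := hM a j lej.
    by have := nsz_linear (n a - j); rewrite /nsz /enc /Enc_nat; lia.
have := pt_seq (pt_seq st0 hw) (pt_seq (pt_prim _ Snd) (pt_prim _ Snd)).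
by apply: pt_ext.
Qed.

End Folds.

Section Catrev.
Context {A B C : Type} {EA : Enc A} {EB : Enc B} {EC : Enc C}.

Lemma PT_catrev (f g : A -> seq B) : PT f -> PT g -> PT (fun a => catrev (f a) (g a)).
Proof.
move=> hf hg.
apply: (@PT_ext _ _ _ _ (fun a => foldl (fun s b => b :: s) (g a) (f a))).
  by move=> a; elim: (f a) (g a) => //= b s IH t; rewrite IH.
apply: (@PT_foldl _ _ _ _ _ _ _ g f (fun a => esize (f a) + esize (g a))) => //.
- by pt_steps.
- by apply: bd_add; apply: PT_bd.
- move=> a j _.
  suff -> : foldl (fun s b => b :: s) (g a) (take j (f a)) = catrev (take j (f a)) (g a).
    rewrite catrevE; apply: leq_trans (esz_cat _ _) _; rewrite esz_rev leq_add2r.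
    exact: esz_take.
  by elim: (take j (f a)) (g a) => //= b s IH t; rewrite IH.
Qed.

End Catrev.

Section Rev.
Context {A B C : Type} {EA : Enc A} {EB : Enc B} {EC : Enc C}.

Lemma PT_rev (f : A -> seq B) : PT f -> PT (fun a => rev (f a)).
Proof. by move=> hf; apply: PT_catrev => //; apply: PT_nil. Qed.

Lemma PT_cat (f g : A -> seq B) : PT f -> PT g -> PT (fun a => f a ++ g a).
Proof.
move=> hf hg; apply: (PT_ext _ (PT_catrev (PT_rev hf) hg)) => a.
by rewrite catrevE revK.
Qed.

End Rev.

Section Map.
Context {A B C : Type} {EA : Enc A} {EB : Enc B} {EC : Enc C}.

Lemma PT_map (f : A -> B -> C) (l : A -> seq B) :
  PT (fun x : A * B => f x.1 x.2) -> PT l -> PT (fun a => [seq f a b | b <- l a]).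
Proof.
move=> hf hl; have [P hP] := PT_bd hf.
have e a (s : seq B) : foldl (fun t b => f a b :: t) [::] s = rev (map (f a) s).
  rewrite -[RHS]cats0 -catrevE; elim: s [::] => //= b s IH t; exact: IH.
apply: (@PT_ext _ _ _ _ (fun a => rev (foldl (fun t b => f a b :: t) [::] (l a)))).
  by move=> a; rewrite e revK.
apply: PT_rev.
apply: (@PT_foldl _ _ _ _ _ _ (fun a t b => f a b :: t) _ l
  (fun a => (esize (l a) * (P.[(esize a + esize (l a)).+1]%R).+1).+1)) => //.
- pt_steps; pt_app2 hf; pt_steps.
- exact: PT_nil.
- apply: bd_S; apply: bd_mul; first exact: PT_bd.
  by apply: bd_S; apply: bd_horner; apply: bd_S; apply: bd_add; [apply: bd_size|apply: PT_bd].
- move=> a j _; rewrite e esz_rev; have := @esz_take _ EB j (l a); move: (take _ _) => s.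
  move: (esize (l a)) => m; elim: s m => [|b s IH] m; first by rewrite esz_nil.
  rewrite map_cons !esz_cons => lem.
  have h1 : esize (f a b) <= (P.[(esize a + m).+1])%R.
    by apply: leq_trans (hP (a, b)) _; apply: horner_nat_mono; rewrite esz_pair; lia.
  have := IH (esize s) (leqnn _).
  have h2 : P.[(esize a + esize s).+1]%R <= P.[(esize a + m).+1]%R by apply: horner_nat_mono; lia.
  move: h1 h2; move: (P.[_]%R) => p; move: (P.[_]%R) => q; nia.
Qed.

End Map.

Section BigOps.
Context {A B C : Type} {EA : Enc A} {EB : Enc B} {EC : Enc C}.

Lemma PT_flatten (f : A -> seq (seq B)) : PT f -> PT (fun a => flatten (f a)).
Proof.
move=> hf.
apply: (@PT_ext _ _ _ _ (fun a => foldl (fun s b => s ++ b) [::] (f a))).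
  by move=> a; rewrite -[RHS]/([::] ++ flatten (f a)); elim: (f a) [::] => [|b s IH] t /=;
    rewrite ?cats0 // IH catA.
apply: (@PT_foldl _ _ _ _ _ _ _ _ f (fun a => esize (f a))) => //.
- apply: PT_cat; pt_steps.
- exact: PT_nil.
- exact: PT_bd.
- move=> a j _; apply: leq_trans (esz_take j (f a)).
  have : esize (foldl (fun s b => s ++ b) [::] (take j (f a))) < esize ([::] : seq B) + esize (take j (f a)).
    elim: (take j (f a)) [::] => [|b s IH] t; first by rewrite esz_nil addn1 ltnS leqnn.
    apply: leq_trans (IH (t ++ b)) _; have := @esz_cat _ EB t b; rewrite !esz_cons; lia.
  by rewrite esz_nil.
Qed.

Lemma PT_bigop (op : Monoid.law 0) (f : A -> B -> nat) (l : A -> seq B) :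
  (forall m n, op m n <= m + n) -> PT (fun x : nat * nat => op x.1 x.2) ->
  PT (fun x : A * B => f x.1 x.2) -> PT l ->
  PT (fun a => \big[op/0]_(b <- l a) f a b).
Proof.
move=> leop hop hf hl; have hm := PT_map hf hl.
have e (s : seq nat) : foldl op 0 s = \big[op/0]_(b <- s) b.
  suff h t : foldl op t s = op t (\big[op/0]_(b <- s) b) by rewrite h Monoid.mul1m.
  elim: s t => [|b s IH] t /=; first by rewrite big_nil Monoid.mulm1.
  by rewrite IH big_cons Monoid.mulmA.
apply: (@PT_ext _ _ _ _ (fun a => foldl op 0 (map (f a) (l a)))).
  by move=> a; rewrite e big_map.
apply: (@PT_foldl _ _ _ _ _ _ (fun=> op) _ _ (fun a => esize (map (f a) (l a)))) => //.
- by pt_app2 hop; pt_steps.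
- exact: PT_nat.
- exact: PT_bd.
- move=> a j _; rewrite e; apply: leq_trans (esz_take j _).
  elim: (take _ _) => [|b s IH]; first by rewrite big_nil.
  rewrite big_cons esz_cons.
  have := nsz_le (leop b (\big[op/0]_(i <- s) i)).
  have := nsz_add b (\big[op/0]_(i <- s) i).
  by move: IH; rewrite /nsz /enc /Enc_nat; lia.
Qed.

Lemma PT_sum (f : A -> B -> nat) (l : A -> seq B) :
  PT (fun x : A * B => f x.1 x.2) -> PT l -> PT (fun a => \sum_(b <- l a) f a b).
Proof.
apply: PT_bigop => //.
exact: (@PT_add (nat * nat)%type _ fst snd (PT_fst PT_id) (PT_snd PT_id)).
Qed.

Lemma PT_max (f : A -> B -> nat) (l : A -> seq B) :
  PT (fun x : A * B => f x.1 x.2) -> PT l -> PT (fun a => \max_(b <- l a) f a b).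
Proof.
apply: PT_bigop => [m n|]; first by rewrite /= geq_max leq_addr leq_addl.
exact: (@PT_maxn (nat * nat)%type _ fst snd (PT_fst PT_id) (PT_snd PT_id)).
Qed.

Lemma PT_size (l : A -> seq B) : PT l -> PT (fun a => size (l a)).
Proof.
move=> hl; apply: (@PT_ext _ _ _ _ (fun a => \sum_(b <- l a) 1)) => [a|].
  by rewrite sum1_size.
by apply: PT_sum => //; pt_steps.
Qed.

Lemma bd_seq_size (l : A -> seq B) : PT l -> bd (@enc A EA) (fun a => size (l a)).
Proof. by move=> hl; apply: bd_le (PT_bd hl) => a; apply: size_esz. Qed.

Lemma PT_horner (P : {poly nat}) (f : A -> nat) : PT f -> PT (fun a => (P.[f a])%R).
Proof.
move=> hf; elim/poly_ind: P => [|P c IH].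
  by apply: (@PT_ext _ _ _ _ (fun=> 0)) => [a|]; [rewrite horner0|apply: PT_nat].
apply: (@PT_ext _ _ _ _ (fun a => (P.[f a])%R * f a + c)) => [a|].
  by rewrite hornerMXaddC.
by pt_steps.
Qed.

End BigOps.

Definition downto n := (iter n (fun x : nat * seq nat => (x.1.+1, x.1 :: x.2)) (0, [::])).2.

Lemma iter_downto n :
  iter n (fun x : nat * seq nat => (x.1.+1, x.1 :: x.2)) (0, [::]) = (n, rev (iota 0 n)).
Proof.
elim: n => // n IH; rewrite iterS IH; congr (_, _).
by rewrite -[RHS]/(rev (iota 0 n.+1)) -addn1 iotaD rev_cat.
Qed.

Lemma downtoE n : downto n = rev (iota 0 n).
Proof. by rewrite /downto iter_downto. Qed.

Lemma PT_downto A (EA : Enc A) (n : A -> nat) :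
  PT n -> bd (@enc A EA) n -> PT (fun a => downto (n a)).
Proof.
move=> hn bn; apply: PT_snd.
apply: (@PT_iter _ _ _ _ (fun=> fun x : nat * seq nat => (x.1.+1, x.1 :: x.2)) _ n
  (fun a => ((n a).+2 + ((n a) * ((n a).+2).+1).+1).+1)) => //.
- by pt_steps.
- by pt_steps.
- by apply: bd_S; apply: bd_add; [do 2 apply: bd_S|apply: bd_S; apply: bd_mul => //; do 3 apply: bd_S].
- move=> a j lej.
  rewrite iter_downto.
  rewrite esz_pair esz_rev.
  have h1 := nsz_linear j.
  have : esize (iota 0 j) <= (size (iota 0 j) * (n a).+2.+1).+1.
    apply: esz_seq_all => i; rewrite mem_iota => ltj.
    by have := nsz_linear i; rewrite /nsz /enc /Enc_nat; lia.
  by rewrite size_iota; move: h1; rewrite /nsz /enc /Enc_nat; nia.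
Qed.

(** * Cheapest walks by dynamic programming *)

Definition argmin (B : Type) (f : seq B -> nat) (l : seq (seq B)) : seq B :=
  foldl (fun acc w => if nilp acc || (f w < f acc) then w else acc) [::] l.

Lemma argmin_sub (B : eqType) (f : seq B -> nat) l : argmin f l \in [::] :: l.
Proof.
suff h acc : foldl (fun acc w => if nilp acc || (f w < f acc) then w else acc) acc l
    \in acc :: l by exact: h.
elim: l acc => [|w l IH] acc /=; first exact: mem_head.
by case: ifP => _; [have := IH w|have := IH acc]; rewrite !inE => /orP[->|->]; rewrite ?orbT.
Qed.

Lemma PT_argmin (A : Type) (B : eqType) (EA : Enc A) (EB : Enc B)
    (f : A -> seq B -> nat) (l : A -> seq (seq B)) :
  PT (fun x : A * seq B => f x.1 x.2) -> PT l -> PT (fun a => argmin (f a) (l a)).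
Proof.
move=> hf hl.
apply: (@PT_foldl _ _ _ _ _ _
  (fun a acc w => if nilp acc || (f a w < f a acc) then w else acc) _ l
  (fun a => esize (l a))) => //.
- by pt_steps; pt_app2 hf; pt_steps.
- exact: PT_nil.
- exact: PT_bd.
- move=> a j _; apply: leq_trans (esz_take j (l a)).
  have := argmin_sub (f a) (take j (l a)); rewrite /argmin inE => /orP[/eqP->|].
    by rewrite esz_nil esz_seq_gt0.
  exact: esz_mem.
Qed.

Lemma PT_allpairs A B C (EA : Enc A) (EB : Enc B) (EC : Enc C)
    (l : A -> seq B) (l' : A -> seq C) :
  PT l -> PT l' -> PT (fun a => [seq (b, c) | b <- l a, c <- l' a]).
Proof.
move=> hl hl'; apply: PT_flatten; apply: (PT_map (f := fun a b => [seq (b, c) | c <- l' a])) => //.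
apply: (PT_map (f := fun (x : A * B) c => (x.2, c))); first by pt_steps.
by cbv beta; pt_app1 hl'; pt_steps.
Qed.

Notation state := (nat * nat)%type.
Notation hop := (state * state)%type.
(* A walk is the list of its hops, last hop first. It begins with the dummy   *)
(* hop [(s0, s0)], so that the end of a walk is always that of its head.      *)
Definition hop0 : hop := ((0, 0), (0, 0)).

Definition wcost (c : hop -> nat) (w : seq hop) := \sum_(m <- w) c m.

Definition dp_step (c : hop -> nat) (keys : seq state) (tab : seq (seq hop)) :=
  [seq argmin (wcost c) [seq ((head hop0 w).2, v) :: w | w <- tab] | v <- keys].

Definition dp c keys s0 k := iter k (dp_step c keys) [:: [:: (s0, s0)]].

Definition tcost c (BIG t : nat) (w : seq hop) :=
  wcost c w + (if (head hop0 w).2.1 == t then 0 else BIG).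

Definition grid (vs : seq nat) L := [seq (v, d) | v <- vs, d <- downto L.+1].

Definition best c BIG vs s t D k :=
  argmin (tcost c BIG t) (dp c (grid vs D) (s, 0) k).

Section PTgrid.
Context {A : Type} {EA : Enc A}.

Lemma PT_wcost (c : A -> hop -> nat) (w : A -> seq hop) :
  PT (fun x : A * hop => c x.1 x.2) -> PT w -> PT (fun a => wcost (c a) (w a)).
Proof. exact: PT_sum. Qed.

Lemma PT_hop0 : PT (fun _ : A => hop0).
Proof. by rewrite /hop0; pt_steps. Qed.

Lemma PT_grid (vs : A -> seq nat) (L : A -> nat) :
  PT vs -> PT L -> bd (@enc A EA) L -> PT (fun a => grid (vs a) (L a)).
Proof.
by move=> hvs hL bL; apply: PT_allpairs => //; apply: PT_downto; [pt_steps|apply: bd_S].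
Qed.
End PTgrid.

Section PTdp_table.
Context {A : Type} {EA : Enc A}.

Lemma PT_dp (c : A -> hop -> nat) (keys : A -> seq state) (s0 : A -> state) (k : A -> nat) :
  PT (fun x : A * hop => c x.1 x.2) -> PT keys -> PT s0 -> PT k -> bd (@enc A EA) k ->
  PT (fun a => dp (c a) (keys a) (s0 a) (k a)).
Proof.
move=> hc hkeys hs hk bk.
have [M eM] : exists M : A -> nat, forall a, M a = esize (keys a) + esize (s0 a).
  by exists (fun a => esize (keys a) + esize (s0 a)).
have [E eE] : exists E : A -> nat, forall a, E a = esize (keys a) by exists (fun a => esize (keys a)).
pose W a j := (j.+1 * (2 * M a).+2).+1.
apply: (@PT_iter _ _ _ _ (fun a => dp_step (c a) (keys a)) _ k
  (fun a => ((E a).+1 * (W a (k a)).+1).+1)) => //.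
- rewrite /dp_step.
  apply: (PT_map (f := fun (x : A * seq (seq hop)) v =>
    argmin (wcost (c x.1)) [seq ((head hop0 w).2, v) :: w | w <- x.2])).
    apply: (PT_argmin (f := fun (x : A * seq (seq hop) * state) => wcost (c x.1.1))).
      apply: (PT_wcost (c := fun (x : A * seq (seq hop) * state * seq hop) => c x.1.1.1)).
        by pt_app2 hc; pt_steps.
      by pt_steps.
    apply: (PT_map (f := fun (x : A * seq (seq hop) * state) w => ((head hop0 w).2, x.2) :: w)).
      by pt_steps; apply: PT_head; [apply: PT_hop0|pt_steps].
    by pt_steps.
  by cbv beta; pt_app1 hkeys; pt_steps.
- by pt_steps.
- have bM : bd (@enc A EA) M
    by apply: (bd_le (g := fun a => esize (keys a) + esize (s0 a))) => [a|];
      [rewrite eM|apply: bd_add; apply: PT_bd].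
  have bE : bd (@enc A EA) E
    by apply: (bd_le (g := fun a => esize (keys a))) => [a|];
      [rewrite eE|apply: PT_bd].
  apply: bd_S; apply: bd_mul; first by apply: bd_S.
  by do 2 apply: bd_S; apply: bd_mul; apply: bd_S => //; apply: bd_S; apply: bd_mul => //; apply: bd_const.
- move=> a j lej.
  pose st i := iter i (dp_step (c a) (keys a)) [:: [:: (s0 a, s0 a)]].
  have e3 : esize ((0, 0) : state) = 3 by rewrite esz_pair.
  have s3 : 3 <= esize (s0 a).
    case: (s0 a) => x y; rewrite esz_pair.
    have := dsize_gt0 (Enc_nat x); have := dsize_gt0 (Enc_nat y); rewrite /enc; lia.
  have inv i : {in st i, forall w, esize w <= W a i /\ esize (head hop0 w).2 <= M a}.
    elim: i => [|i IH] w.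
      rewrite inE => /eqP->; rewrite /W eM esz_cons esz_nil esz_pair /=; lia.
    rewrite /st iterS -/(st i) => /mapP[v vk ->].
    have := argmin_sub (wcost (c a)) [seq ((head hop0 w).2, v) :: w | w <- st i].
    rewrite inE => /orP[/eqP->|/mapP[w' /IH[h1 h2] ->]].
      by rewrite esz_nil [head _ _]/= e3 /W eM; lia.
    have hv : esize v <= esize (keys a) by exact: esz_mem.
    rewrite esz_cons esz_pair [head _ (_ :: _)]/=.
    move: h1 h2 hv; rewrite /W eM => h1 h2 hv; split; last exact: leq_trans hv (leq_addr _ _).
    rewrite (mulSn i.+1); move: h1; move: (i.+1 * _) => X h1.
    have ar h b x K S : h <= K + S -> b <= K -> x <= X.+1 ->
        (h + b).+1 + x < ((2 * (K + S)).+2 + X).+1 by lia.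
    exact: ar h2 hv h1.
  have sz : size (st j) <= (E a).+1.
    by case: (j) => [|i] //=; rewrite eE size_map; apply: leq_trans (size_esz _) _.
  have hs' : esize (st j) <= (size (st j) * (W a (k a)).+1).+1.
    apply: esz_seq_all => w /inv[h _]; apply: leq_trans h _.
    by rewrite /W ltnS leq_mul2r ltnS lej orbT.
  by apply: leq_trans hs' _; rewrite ltnS leq_mul2r sz orbT.
Qed.

Lemma PT_tcost (c : A -> hop -> nat) (BIG t : A -> nat) (w : A -> seq hop) :
  PT (fun x : A * hop => c x.1 x.2) -> PT BIG -> PT t -> PT w ->
  PT (fun a => tcost (c a) (BIG a) (t a) (w a)).
Proof.
move=> hc hB ht hw; rewrite /tcost; pt_steps; first exact: PT_wcost.
by apply: PT_eq; [exact: PTeq_nat| |exact: ht]; pt_steps; apply: PT_head => //; apply: PT_hop0.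
all: done.
Qed.
End PTdp_table.

Section PTbest.
Context {A : Type} {EA : Enc A}.

Lemma PT_best (c : A -> hop -> nat) (BIG s t D k : A -> nat) (vs : A -> seq nat) :
  PT (fun x : A * hop => c x.1 x.2) -> PT BIG -> PT vs -> PT s -> PT t ->
  PT D -> bd (@enc A EA) D -> PT k -> bd (@enc A EA) k ->
  PT (fun a => best (c a) (BIG a) (vs a) (s a) (t a) (D a) (k a)).
Proof.
move=> hc hB hvs hs ht hD bD hk bk; apply: (PT_argmin (f := fun a => tcost (c a) (BIG a) (t a))).
  apply: (PT_tcost (c := fun (x : A * seq hop) => c x.1)).
  - by pt_app2 hc; pt_steps.
  - by cbv beta; pt_app1 hB; pt_steps.
  - by cbv beta; pt_app1 ht; pt_steps.
  - by pt_steps.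
apply: PT_dp => //; first exact: PT_grid.
by pt_steps.
Qed.
End PTbest.

(** * The queueing algorithm *)

Notation edge := (nat * nat)%type.
Notation demand := (edge * nat)%type.
Notation raw_instance := (seq nat * (seq (edge * nat) * (seq demand * nat)))%type.
Notation tab := (seq ((demand * edge) * (nat * nat))).

Section Algorithm.
Variables (q : {poly nat}) (prec : nat).
Implicit Types (I : raw_instance) (e : edge) (m : hop) (d : demand) (t : tab).

Definition nb_vertices I := size I.1.
Definition in_E I e := 0 < \sum_(x <- I.2.1) (x.1 == e).
Definition edge_len I e := \sum_(x <- I.2.1) (x.1 == e) * x.2.

(* A state is a vertex with the length budget used so far. Staying put is     *)
(* free, so that walks with exactly [k] hops represent those with at most     *)
(* [k]; forbidden hops cost [BIG], more than any legal walk.                  *)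
Definition hop_cost (al : edge -> bool) (l b : edge -> nat) (BIG : nat) m :=
  if (m.1.1 == m.2.1) && (m.1.2 <= m.2.2) then 0
  else if al (m.1.1, m.2.1) && (m.1.2 + l (m.1.1, m.2.1) <= m.2.2)
       then b (m.1.1, m.2.1) else BIG.

Definition dist_penalty I := (nb_vertices I * q.[nb_vertices I]%R).+1.
Definition dist_cost I := hop_cost (in_E I) (fun=> 0) (edge_len I) (dist_penalty I).
Definition dist I e :=
  tcost (dist_cost I) (dist_penalty I) e.2
    (best (dist_cost I) (dist_penalty I) I.1 e.1 e.2 0 (nb_vertices I)).
Definition in_EM I e := dist I e < dist_penalty I.

(* [slack] bounds the error terms [2 |D| + |D| |E~|] of one round of the      *)
(* potential argument; with [prec >= 1 / eps] the threshold and the number of *)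
(* rounds are what [budget] below requires.                                   *)
Definition slack I := 3 * (nb_vertices I * nb_vertices I * (nb_vertices I * nb_vertices I)).
Definition threshold I := slack I * prec.
Definition nb_rounds I := (12 * (slack I * slack I) * (prec * prec * prec)).+1.
Definition walk_penalty I := (nb_vertices I * (nb_rounds I).+1).+1.
Definition max_length I := nb_vertices I * (nb_vertices I * q.[nb_vertices I]%R).

(* A maximum rather than a sum: the values cannot exceed the number of rounds *)
(* even on a malformed input with repeated keys.                              *)
Definition queue_lookup t k := \max_(x <- t) (x.1 == k) * x.2.1.
Definition flow_lookup t k := \max_(x <- t) (x.1 == k) * x.2.2.

(* Without the [.+1] a demand routable inside [E] might use an edge outside   *)
(* [E] whose queue is empty, and an optimum of 0 would be missed.             *)
Definition edge_weight I t d e := if in_E I e then 0 else (queue_lookup t (d, e)).+1.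
Definition walk_cost I t d := hop_cost (in_EM I) (dist I) (edge_weight I t d) (walk_penalty I).
Definition walk I t d :=
  best (walk_cost I t d) (walk_penalty I) I.1 d.1.1 d.1.2
    (minn d.2 (max_length I)) (minn I.2.2.2 (nb_vertices I)).
Definition routed I t d e :=
  ~~ (e.1 == e.2) && (0 < \sum_(m <- walk I t d) ((m.1.1, m.2.1) == e)).
Definition load I t e := \sum_(d <- I.2.2.1) queue_lookup t (d, e).

Definition pairs I := [seq (u, v) | u <- I.1, v <- I.1].
Definition table_keys I := [seq (d, e) | d <- I.2.2.1, e <- pairs I].

Definition round_step I t : tab :=
  [seq (k, (queue_lookup t k + routed I t k.1 k.2 - (threshold I < load I t k.2),
            flow_lookup t k + routed I t k.1 k.2)) | k <- table_keys I].
Definition rounds I := iter (nb_rounds I) (round_step I) [::].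

Definition numerator I t e := if in_E I e then nb_rounds I else \max_(d <- I.2.2.1) flow_lookup t (d, e).
Definition output I :=
  [seq [seq (numerator I (rounds I) (u, v), nb_rounds I) | v <- I.1] | u <- I.1].

Section PTparameters.
Context {A : Type} {EA : Enc A}.
Implicit Types (fI : A -> raw_instance) (fe : A -> edge) (ft : A -> tab) (fd : A -> demand).

Lemma PT_nb_vertices fI : PT fI -> PT (fun a => nb_vertices (fI a)).
Proof. by move=> h; apply: PT_size; pt_steps. Qed.

Lemma bd_nb_vertices fI : PT fI -> bd (@enc A EA) (fun a => nb_vertices (fI a)).
Proof. by move=> h; apply: bd_seq_size; pt_steps. Qed.

Lemma PT_in_E fI fe : PT fI -> PT fe -> PT (fun a => in_E (fI a) (fe a)).
Proof.
move=> hI he; rewrite /in_E; pt_steps.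
apply: (PT_sum (f := fun a x => (x.1 == fe a : nat))); last by pt_steps.
pt_steps; apply: PT_eq; [exact: PTeq_prod PTeq_nat PTeq_nat|by pt_steps|].
by pt_app1 he; pt_steps.
Qed.

Lemma PT_edge_len fI fe : PT fI -> PT fe -> PT (fun a => edge_len (fI a) (fe a)).
Proof.
move=> hI he; apply: (PT_sum (f := fun a x => (x.1 == fe a) * x.2)); last by pt_steps.
pt_steps; apply: PT_eq; [exact: PTeq_prod PTeq_nat PTeq_nat|by pt_steps|].
by pt_app1 he; pt_steps.
Qed.

Lemma PT_hop_cost (al : A -> edge -> bool) (l b : A -> edge -> nat) (BIG : A -> nat)
    (m : A -> hop) :
  PT (fun x : A * edge => al x.1 x.2) -> PT (fun x : A * edge => l x.1 x.2) ->
  PT (fun x : A * edge => b x.1 x.2) -> PT BIG -> PT m ->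
  PT (fun a => hop_cost (al a) (l a) (b a) (BIG a) (m a)).
Proof.
move=> hal hl hb hB hm; rewrite /hop_cost; pt_steps => //.
- by apply: PT_eq; [exact: PTeq_nat|pt_steps|pt_steps].
- by apply: (@PT_comp2 _ _ _ _ _ _ _ _ al id (fun a => ((m a).1.1, (m a).2.1)) hal); pt_steps.
- by apply: (@PT_comp2 _ _ _ _ _ _ _ _ l id (fun a => ((m a).1.1, (m a).2.1)) hl); pt_steps.
- by apply: (@PT_comp2 _ _ _ _ _ _ _ _ b id (fun a => ((m a).1.1, (m a).2.1)) hb); pt_steps.
Qed.

Lemma PT_dist_penalty fI : PT fI -> PT (fun a => dist_penalty (fI a)).
Proof.
move=> h; have hn := PT_nb_vertices h; rewrite /dist_penalty; pt_steps => //.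
exact: PT_horner.
Qed.

Lemma PT_slack fI : PT fI -> PT (fun a => slack (fI a)).
Proof. by move=> h; have hn := PT_nb_vertices h; rewrite /slack; pt_steps. Qed.

Lemma bd_slack fI : PT fI -> bd (@enc A EA) (fun a => slack (fI a)).
Proof.
move=> h; have bn := bd_nb_vertices h.
by apply: bd_mul; [apply: bd_const|do 2 apply: bd_mul => //].
Qed.

Lemma PT_nb_rounds fI : PT fI -> PT (fun a => nb_rounds (fI a)).
Proof. by move=> h; have hn := PT_slack h; rewrite /nb_rounds; pt_steps. Qed.

Lemma bd_nb_rounds fI : PT fI -> bd (@enc A EA) (fun a => nb_rounds (fI a)).
Proof.
move=> h; have bn := bd_slack h; apply: bd_S; apply: bd_mul; last exact: bd_const.
by apply: bd_mul; [apply: bd_const|apply: bd_mul].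
Qed.

Lemma PT_threshold fI : PT fI -> PT (fun a => threshold (fI a)).
Proof. by move=> h; have hn := PT_slack h; rewrite /threshold; pt_steps. Qed.

Lemma PT_walk_penalty fI : PT fI -> PT (fun a => walk_penalty (fI a)).
Proof.
move=> h; have hn := PT_nb_vertices h; have ht := PT_nb_rounds h.
by rewrite /walk_penalty; pt_steps.
Qed.

Lemma PT_max_length fI : PT fI -> PT (fun a => max_length (fI a)).
Proof.
by move=> h; have hn := PT_nb_vertices h; rewrite /max_length; pt_steps => //; exact: PT_horner.
Qed.

Lemma bd_max_length fI : PT fI -> bd (@enc A EA) (fun a => max_length (fI a)).
Proof.
by move=> h; have bn := bd_nb_vertices h; do 2 apply: bd_mul => //; apply: bd_horner.
Qed.

End PTparameters.

Section PTlookup.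
Context {A : Type} {EA : Enc A}.
Implicit Types (fI : A -> raw_instance) (fe : A -> edge) (ft : A -> tab) (fd : A -> demand).

Lemma PT_dist_cost fI : PT fI -> PT (fun x : A * hop => dist_cost (fI x.1) x.2).
Proof.
move=> h; have h1 : PT (fun x : A * hop => fI x.1) by pt_app1 h; pt_steps.
have h2 : PT (fun x : A * hop * edge => fI x.1.1) by pt_app1 h; pt_steps.
apply: (PT_hop_cost (A := A * hop) (al := fun x => in_E (fI x.1)) (l := fun x _ => 0)
   (b := fun x => edge_len (fI x.1)) (BIG := fun x => dist_penalty (fI x.1)) (m := fun x => x.2)).
- by apply: PT_in_E => //; pt_steps.
- by pt_steps.
- by apply: PT_edge_len => //; pt_steps.
- exact: PT_dist_penalty.
- by pt_steps.
Qed.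

Lemma PT_queue_lookup ft (fk : A -> demand * edge) :
  PT ft -> PT fk -> PT (fun a => queue_lookup (ft a) (fk a)).
Proof.
move=> ht hk; apply: (PT_max (f := fun a x => (x.1 == fk a) * x.2.1)) => //.
pt_steps; apply: PT_eq; [by pt_eqs|by pt_steps|].
by pt_app1 hk; pt_steps.
Qed.

Lemma PT_flow_lookup ft (fk : A -> demand * edge) :
  PT ft -> PT fk -> PT (fun a => flow_lookup (ft a) (fk a)).
Proof.
move=> ht hk; apply: (PT_max (f := fun a x => (x.1 == fk a) * x.2.2)) => //.
pt_steps; apply: PT_eq; [by pt_eqs|by pt_steps|].
by pt_app1 hk; pt_steps.
Qed.

Lemma PT_pairs fI : PT fI -> PT (fun a => pairs (fI a)).
Proof. by move=> h; apply: PT_allpairs; pt_steps. Qed.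
End PTlookup.

Section PTdistance.
Context {A : Type} {EA : Enc A}.
Implicit Types (fI : A -> raw_instance) (fe : A -> edge) (ft : A -> tab) (fd : A -> demand).

Lemma PT_dist fI fe : PT fI -> PT fe -> PT (fun a => dist (fI a) (fe a)).
Proof.
move=> hI he; apply: (PT_tcost (c := fun a => dist_cost (fI a))).
- exact: PT_dist_cost.
- exact: PT_dist_penalty.
- by pt_steps.
- apply: (PT_best (c := fun a => dist_cost (fI a)) (D := fun=> 0)).
  + exact: PT_dist_cost.
  + exact: PT_dist_penalty.
  + by pt_steps.
  + by pt_steps.
  + by pt_steps.
  + by pt_steps.
  + exact: bd_const.
  + exact: PT_nb_vertices.
  + exact: bd_nb_vertices.
Qed.

Lemma PT_load fI ft fe : PT fI -> PT ft -> PT fe -> PT (fun a => load (fI a) (ft a) (fe a)).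
Proof.
move=> hI ht he; apply: (PT_sum (f := fun a d => queue_lookup (ft a) (d, fe a))).
  by apply: PT_queue_lookup; pt_steps; [pt_app1 ht|pt_app1 he]; pt_steps.
by pt_steps.
Qed.

Lemma PT_table_keys fI : PT fI -> PT (fun a => table_keys (fI a)).
Proof. by move=> h; apply: PT_allpairs; [pt_steps|exact: PT_pairs]. Qed.
End PTdistance.

Section PTweight.
Context {A : Type} {EA : Enc A}.
Implicit Types (fI : A -> raw_instance) (fe : A -> edge) (ft : A -> tab) (fd : A -> demand).

Lemma PT_in_EM fI fe : PT fI -> PT fe -> PT (fun a => in_EM (fI a) (fe a)).
Proof.
move=> hI he; rewrite /in_EM; pt_steps; first exact: PT_dist.
exact: PT_dist_penalty.
Qed.

Lemma PT_edge_weight fI ft fd fe :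
  PT fI -> PT ft -> PT fd -> PT fe -> PT (fun a => edge_weight (fI a) (ft a) (fd a) (fe a)).
Proof.
move=> hI ht hd he; rewrite /edge_weight; pt_steps; first exact: PT_in_E.
by apply: PT_queue_lookup => //; pt_steps.
Qed.
End PTweight.

Section PTwalk.
Context {A : Type} {EA : Enc A}.
Implicit Types (fI : A -> raw_instance) (fe : A -> edge) (ft : A -> tab) (fd : A -> demand).

Lemma PT_walk fI ft fd :
  PT fI -> PT ft -> PT fd -> PT (fun a => walk (fI a) (ft a) (fd a)).
Proof.
move=> hI ht hd; apply: (PT_best (c := fun a => walk_cost (fI a) (ft a) (fd a))
   (D := fun a => minn (fd a).2 (max_length (fI a)))).
- have hI1 : PT (fun x : A * hop => fI x.1) by pt_app1 hI; pt_steps.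
  have hI2 : PT (fun x : A * hop * edge => fI x.1.1) by pt_app1 hI; pt_steps.
  have ht2 : PT (fun x : A * hop * edge => ft x.1.1) by pt_app1 ht; pt_steps.
  have hd2 : PT (fun x : A * hop * edge => fd x.1.1) by pt_app1 hd; pt_steps.
  apply: (PT_hop_cost (A := A * hop) (al := fun x => in_EM (fI x.1)) (l := fun x => dist (fI x.1))
   (b := fun x => edge_weight (fI x.1) (ft x.1) (fd x.1))
   (BIG := fun x => walk_penalty (fI x.1)) (m := fun x => x.2)).
  + by apply: PT_in_EM => //; pt_steps.
  + by apply: PT_dist => //; pt_steps.
  + by apply: PT_edge_weight => //; pt_steps.
  + exact: PT_walk_penalty.
  + by pt_steps.
- exact: PT_walk_penalty.
- by pt_steps.
- by pt_steps.
- by pt_steps.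
- by pt_steps => //; exact: PT_max_length.
- by apply: bd_le (bd_max_length hI) => a; exact: geq_minr.
- by pt_steps => //; exact: PT_nb_vertices.
- by apply: bd_le (bd_nb_vertices hI) => a; exact: geq_minr.
Qed.
End PTwalk.

Section PTrouted.
Context {A : Type} {EA : Enc A}.
Implicit Types (fI : A -> raw_instance) (fe : A -> edge) (ft : A -> tab) (fd : A -> demand).

Lemma PT_routed fI ft fd fe :
  PT fI -> PT ft -> PT fd -> PT fe -> PT (fun a => routed (fI a) (ft a) (fd a) (fe a)).
Proof.
move=> hI ht hd he; rewrite /routed; pt_steps.
  by apply: PT_eq; [exact: PTeq_nat|pt_steps|pt_steps].
apply: (PT_sum (f := fun a m => ((m.1.1, m.2.1) == fe a : nat))); last exact: PT_walk.
pt_steps; apply: PT_eq; [by pt_eqs|by pt_steps|].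
by pt_app1 he; pt_steps.
Qed.
End PTrouted.

Lemma rounds_bound I j :
  {in iter j (round_step I) [::], forall x, [&& x.1 \in table_keys I, x.2.1 <= j & x.2.2 <= j]}.
Proof.
elim: j => // j IH x; rewrite iterS => /mapP[k kk' ->] /=; rewrite kk' /=.
set t := iter j _ _ in IH *.
have hl : routed I t k.1 k.2 <= 1 by case: routed.
have [hQ hF] : queue_lookup t k <= j /\ flow_lookup t k <= j.
  split; apply/bigmax_leqP_seq => y /IH/and3P[_ h1 h2] _; rewrite -[leqRHS]mul1n leq_mul ?leq_b1 ?h1 ?h2 //.
by lia.
Qed.

Lemma PT_rounds : PT rounds.
Proof.
have [E eE] : exists E : raw_instance -> nat, forall I, E I = esize (table_keys I)
  by exists (fun I => esize (table_keys I)).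
have bE : bd (@enc raw_instance _) E.
  apply: (bd_le (g := fun I => esize (table_keys I))) => [I|]; first by rewrite eE.
  by apply: PT_bd; apply: PT_table_keys; exact: PT_id.
have bT : bd (@enc raw_instance _) nb_rounds by apply: bd_nb_rounds; exact: PT_id.
apply: (@PT_iter _ _ _ _ round_step (fun=> [::]) nb_rounds
  (fun I => (E I * (E I + ((nb_rounds I).+2 + (nb_rounds I).+2).+1).+2).+1)).
- rewrite /round_step.
  have hI : PT (fun x : raw_instance * tab * (demand * edge) => x.1.1) by pt_steps.
  have ht : PT (fun x : raw_instance * tab * (demand * edge) => x.1.2) by pt_steps.
  apply: (PT_map (f := fun (x : raw_instance * tab) k =>
      (k, (queue_lookup x.2 k + routed x.1 x.2 k.1 k.2 - (threshold x.1 < load x.1 x.2 k.2),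
            flow_lookup x.2 k + routed x.1 x.2 k.1 k.2)))).
    pt_steps.
    + by apply: PT_queue_lookup; pt_steps.
    + by apply: PT_routed; pt_steps.
    + by apply: PT_threshold.
    + by apply: PT_load; pt_steps.
    + by apply: PT_flow_lookup; pt_steps.
    + by apply: PT_routed; pt_steps.
  by apply: PT_table_keys; pt_steps.
- exact: PT_nil.
- by apply: PT_nb_rounds; exact: PT_id.
- exact: bT.
- apply: bd_S; apply: bd_mul => //; do 2 apply: bd_S; apply: bd_add => //.
  by apply: bd_S; apply: bd_add; do 2 apply: bd_S.
- move=> I j lej.
  have sz : size (iter j (round_step I) [::]) <= E I.
    by case: (j) => [|i] //=; rewrite eE size_map size_esz.
  have hs : esize (iter j (round_step I) [::]) <=
      (size (iter j (round_step I) [::]) * (E I + ((nb_rounds I).+2 + (nb_rounds I).+2).+1).+2).+1.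
    apply: esz_seq_all => x /rounds_bound/and3P[xk h1 h2].
    case: x xk h1 h2 => k [Q F] xk h1 h2; simpl in xk, h1, h2.
    have hk : esize k <= E I by rewrite eE; exact: esz_mem.
    have ar a b c : a <= E I -> b <= (nb_rounds I).+2 -> c <= (nb_rounds I).+2 ->
      (a + (b + c).+1).+1 <= (E I + ((nb_rounds I).+2 + (nb_rounds I).+2).+1).+1 by lia.
    apply: (ar (esize k) (nsz Q) (nsz F) hk).
      by apply: leq_trans (nsz_linear Q) _; lia.
    by apply: leq_trans (nsz_linear F) _; lia.
  by apply: leq_trans hs _; rewrite ltnS leq_mul2r sz orbT.
Qed.

Lemma PT_numerator (A : Type) (EA : Enc A) (fI : A -> raw_instance) (ft : A -> tab) (fe : A -> edge) :
  PT fI -> PT ft -> PT fe -> PT (fun a => numerator (fI a) (ft a) (fe a)).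
Proof.
move=> hI ht he; rewrite /numerator; apply: PT_if; [exact: PT_in_E|exact: PT_nb_rounds|].
apply: (PT_max (f := fun a d => flow_lookup (ft a) (d, fe a))); last by pt_steps.
by apply: PT_flow_lookup; pt_steps; [pt_app1 ht|pt_app1 he]; pt_steps.
Qed.

Lemma PT_output : PT output.
Proof.
have hR : PT (fun x : raw_instance * nat * nat => rounds x.1.1) by pt_app1 PT_rounds; pt_steps.
apply: (PT_map (f := fun I u => [seq (numerator I (rounds I) (u, v), nb_rounds I) | v <- I.1]));
  last by pt_steps.
apply: (PT_map (f := fun (x : raw_instance * nat) v =>
  (numerator x.1 (rounds x.1) (x.2, v), nb_rounds x.1))); last by pt_steps.
pt_steps; first by apply: PT_numerator => //; pt_steps.
by apply: PT_nb_rounds; pt_steps.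
Qed.

End Algorithm.

(** * Correctness of the walks and distances *)

Lemma argmin_spec (B : eqType) (f : seq B -> nat) l :
  l != [::] -> [::] \notin l ->
  argmin f l \in l /\ {in l, forall w, f (argmin f l) <= f w}.
Proof.
pose g acc w := if nilp acc || (f w < f acc) then w else acc.
have h s acc : acc != [::] -> [::] \notin s ->
    foldl g acc s \in acc :: s /\ {in acc :: s, forall w, f (foldl g acc s) <= f w}.
  elim: s acc => [|w s IH] acc na ns /=.
    by split=> [|w]; rewrite inE // => /eqP->.
  move: ns; rewrite inE negb_or eq_sym => /andP[nw ns].
  have ng : g acc w != [::] by rewrite /g; case: ifP.
  have [h1 h2] := IH _ ng ns; split.
    move: h1; rewrite /g; case: ifP => _; rewrite !inE => /orP[->|->]; rewrite ?orbT //.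
  move=> v; rewrite inE => /orP[/eqP->|].
    apply: leq_trans (h2 _ (mem_head _ _)) _; rewrite /g.
    by case: acc na {h1 h2 ng} => // a acc _ /=; case: ltnP => // /ltnW.
  rewrite inE => /orP[/eqP->|vs].
    apply: leq_trans (h2 _ (mem_head _ _)) _; rewrite /g.
    by case: acc na {h1 h2 ng} => // a acc _ /=; case: ltnP.
  by apply: h2; rewrite inE vs orbT.
case: l => // w l _; rewrite inE negb_or eq_sym => /andP[nw nl].
exact: (h l w nw nl).
Qed.

Inductive dp_walk (keys : seq state) (s0 : state) : nat -> seq hop -> Prop :=
  | dp_walk0 : dp_walk keys s0 0 [:: (s0, s0)]
  | dp_walkS j w v : dp_walk keys s0 j w -> v \in keys ->
      dp_walk keys s0 j.+1 (((head hop0 w).2, v) :: w).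

Section DP.
Variables (c : hop -> nat) (keys : seq state) (s0 : state).

Lemma dp_neq0 j : keys != [::] -> dp c keys s0 j != [::].
Proof. by case: j => // j; rewrite /dp iterS /dp_step; case: keys. Qed.

Lemma dp_entry j v : keys != [::] ->
  let w := argmin (wcost c) [seq ((head hop0 w).2, v) :: w | w <- dp c keys s0 j] in
  (exists2 w', w' \in dp c keys s0 j & w = ((head hop0 w').2, v) :: w') /\
  forall w', w' \in dp c keys s0 j -> wcost c w <= wcost c (((head hop0 w').2, v) :: w').
Proof.
move=> nk; set l := [seq _ | w <- _] => /=.
have [||/mapP h1 h2] := @argmin_spec _ (wcost c) l.
- by rewrite /l; case: (dp c keys s0 j) (dp_neq0 j nk).
- by apply/negP => /mapP[].
- by split=> // w' w'd; apply: h2; apply: map_f.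
Qed.

Lemma dp_sound j w : w \in dp c keys s0 j -> dp_walk keys s0 j w.
Proof.
elim: j w => [|j IH] w; first by rewrite inE => /eqP->; constructor.
rewrite /dp iterS => /mapP[v vk ->].
have nk : keys != [::] by case: keys vk.
by have [[w' /IH h ->] _] := dp_entry j v nk; constructor.
Qed.

Lemma dp_opt j w : dp_walk keys s0 j w ->
  exists w', [/\ w' \in dp c keys s0 j, (head hop0 w').2 = (head hop0 w).2
    & wcost c w' <= wcost c w].
Proof.
elim=> [|{}j {}w v _ [w' [h1 h2 h3]] vk].
  by exists [:: (s0, s0)]; rewrite inE.
have nk : keys != [::] by case: keys vk.
have [[w1 w1d e1] h4] := dp_entry j v nk.
exists (argmin (wcost c) [seq ((head hop0 w).2, v) :: w | w <- dp c keys s0 j]); split.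
- by rewrite /dp iterS; apply: map_f.
- by rewrite e1.
- apply: leq_trans (h4 _ h1) _; rewrite /wcost !big_cons h2 leq_add2l; exact: h3.
Qed.
End DP.

Lemma best_spec c BIG vs s t D k : s \in vs ->
  dp_walk (grid vs D) (s, 0) k (best c BIG vs s t D k) /\
  forall w, dp_walk (grid vs D) (s, 0) k w ->
    tcost c BIG t (best c BIG vs s t D k) <= tcost c BIG t w.
Proof.
move=> svs; have nk : grid vs D != [::].
  have : (s, 0) \in grid vs D.
    by apply: allpairs_f => //; rewrite downtoE mem_rev mem_iota.
  by case: grid.
have wne j w : dp_walk (grid vs D) (s, 0) j w -> w != [::] by case.
have [||h1 h2] := @argmin_spec _ (tcost c BIG t) (dp c (grid vs D) (s, 0) k).
- exact: dp_neq0.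
- by apply/negP => /dp_sound/wne.
- split=> [|w /(dp_opt c)[w' [h3 h4 h5]]]; first exact: dp_sound h1.
  apply: leq_trans (h2 _ h3) _; rewrite /tcost h4 leq_add2r; exact: h5.
Qed.

Definition steps (T : Type) (u : T) (p : seq T) := zip (u :: p) p.

Lemma steps_rcons T (u : T) p v : steps u (rcons p v) = rcons (steps u p) (last u p, v).
Proof.
rewrite /steps; elim: p u => [|w p IH] u //=.
by congr (_ :: _); rewrite -IH.
Qed.

Lemma steps_cat T (u : T) p1 p2 :
  steps u (p1 ++ p2) = steps u p1 ++ steps (last u p1) p2.
Proof. by rewrite /steps; elim: p1 u => //= a p1 IH u; rewrite IH. Qed.

Definition hop_edge (m : hop) : edge := (m.1.1, m.2.1).

Section Walks.
Variables (al : edge -> bool) (l b : edge -> nat) (BIG : nat).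
Variables (vs : seq nat) (s D : nat).
Hypothesis svs : s \in vs.
Let c := hop_cost al l b BIG.
Let keys := grid vs D.
Let arel : rel nat := fun u v => al (u, v).

Lemma mem_grid v d : ((v, d) \in keys) = (v \in vs) && (d <= D).
Proof.
apply/allpairsP/andP => [[[x y] /= [h1 h2 [-> ->]]]|[h1 h2]].
  by move: h2; rewrite downtoE mem_rev mem_iota add0n ltnS.
by exists (v, d); split=> //=; rewrite downtoE mem_rev mem_iota.
Qed.

Lemma dp_walk_head j w : dp_walk keys (s, 0) j w -> ((head hop0 w).2.1 \in vs) && ((head hop0 w).2.2 <= D).
Proof. by case=> [|{}j {}w [v d] _ /=]; rewrite ?svs // mem_grid. Qed.

Lemma path_walk p j : path arel s p -> all [in vs] p -> size p <= j ->
  \sum_(e <- steps s p) l e <= D ->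
  exists w, [/\ dp_walk keys (s, 0) j w, (head hop0 w).2 = (last s p, \sum_(e <- steps s p) l e)
    & wcost c w <= \sum_(e <- steps s p) b e].
Proof.
elim: j p => [|j IH] p.
  case: p => // _ _ _ _; exists [:: ((s, 0), (s, 0))]; split; first exact: dp_walk0.
    by rewrite /= big_nil.
  by rewrite /wcost big_seq1 /c /hop_cost /= eqxx.
case/lastP: p => [_ _ _ _|p v].
  have [||||w [h1 h2 h3]] := IH [::] => //; first by rewrite big_nil.
  exists (((s, 0), (s, 0)) :: w); split.
  - have := dp_walkS h1 (_ : (s, 0) \in keys); rewrite h2 big_nil; apply.
    by rewrite mem_grid svs.
  - by rewrite /= big_nil.
  - by rewrite /wcost big_cons {1}/c /hop_cost /= eqxx.
rewrite rcons_path all_rcons size_rcons ltnS steps_rcons !big_rcons last_rcons /=.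
move=> /andP[pp av] /andP[vvs pvs] sz le.
have [||||w [h1 h2 h3]] := IH p => //; first by apply: leq_trans le; rewrite leq_addr.
set L := \sum_(e <- _) _ in le h2 *.
exists (((last s p, L), (v, L + l (last s p, v))) :: w); split=> //.
- by rewrite -h2; apply: dp_walkS => //; rewrite mem_grid vvs.
- rewrite /wcost big_cons [X in _ <= X]addnC; apply: leq_add => //.
  rewrite /c /hop_cost /=; case: ifP => // _.
  by rewrite -[al _]/(arel _ _) av leqnn.
Qed.

Lemma walk_path j w : dp_walk keys (s, 0) j w -> wcost c w < BIG ->
  exists p, [/\ path arel s p, last s p = (head hop0 w).2.1, size p <= j,
    \sum_(e <- steps s p) l e <= (head hop0 w).2.2 & uniq (s :: p) &&
    all [in [seq hop_edge m | m <- w]] (steps s p) && all [in vs] p].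
Proof.
elim=> [_|{}j {}w [v d'] hw IH vk].
  by exists [::]; split=> //=; rewrite big_nil.
rewrite /wcost big_cons => lt.
have [|p [pp pl sz len /andP[/andP[un mv] pvs]]] := IH; first by apply: leq_ltn_trans lt; rewrite leq_addl.
move: lt; rewrite {1}/c /hop_cost /=; case: ifP => [/andP[/eqP ev led] _|nstay].
  exists p; split=> //; [by rewrite pl|by apply: leq_trans sz _|exact: leq_trans len led|].
  move: un => /= ->; rewrite pvs andbT /=; apply: sub_all mv => e /=; rewrite !inE => ->; exact: orbT.
case: ifP => [/andP[ha hl] _|_]; last by rewrite ltnNge leq_addr.
have hvs : v \in vs by move: vk; rewrite mem_grid => /andP[].
case: (boolP (v \in s :: p)) => vp.
  case/splitPl: vp pp un mv pvs sz len pl => p1 p2 e1.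
  rewrite cat_path => /andP[pp1 _]; rewrite -cat_cons cat_uniq => /andP[un1 _].
  rewrite steps_cat !all_cat size_cat big_cat /= => /andP[mv1 _] /andP[pvs1 _] sz len _.
  exists p1; split=> //; [by lia| |].
  - by apply: leq_trans hl; apply: leq_trans _ (leq_addr _ _); apply: leq_trans len; rewrite leq_addr.
  - move: un1; rewrite /= => ->; rewrite pvs1 andbT /=; apply: sub_all mv1 => e /=.
    by rewrite !inE => ->; exact: orbT.
exists (rcons p v); split.
- by rewrite rcons_path pp pl.
- by rewrite last_rcons.
- by rewrite size_rcons.
- by rewrite steps_rcons big_rcons /= pl; lia.
- have : uniq (s :: rcons p v) by rewrite -rcons_cons rcons_uniq vp un.
  move=> /= ->; rewrite steps_rcons !all_rcons hvs pvs /= pl inE eqxx /= andbT.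
  by apply: sub_all mv => e /=; rewrite !inE => ->; exact: orbT.
Qed.

Lemma walk_weight j w (E : seq edge) : dp_walk keys (s, 0) j w -> wcost c w < BIG -> uniq E ->
  \sum_(e <- E | e.1 != e.2) (e \in [seq hop_edge m | m <- w]) * b e <= wcost c w.
Proof.
move=> hw lt un; elim: hw lt => [_|{}j {}w [v d'] hw IH vk].
  rewrite big1 // => e ne; rewrite inE /hop_edge /=; case: eqP => // e1.
  by rewrite e1 eqxx in ne.
rewrite /wcost big_cons => lt.
apply: leq_trans (_ : _ <= \sum_(e <- E | e.1 != e.2) ((e == hop_edge ((head hop0 w).2, (v, d'))) * b e
   + (e \in [seq hop_edge m | m <- w]) * b e)) _.
  by apply: leq_sum => e _; rewrite inE; case: eqP; rewrite ?leq_addr // !mul0n.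
rewrite big_split /=; apply: leq_add; last by apply: IH; apply: leq_ltn_trans lt; rewrite leq_addl.
move: lt; rewrite /c /hop_cost /hop_edge /=; set e0 := (_, _).
case: ifP => [/andP[/eqP ev _] _|_].
  rewrite big1 // => e ne; case: eqP => // e1; by rewrite e1 /e0 /= ev eqxx in ne.
case: ifP => [_ _|_]; last by rewrite ltnNge leq_addr.
rewrite big_mkcond /=.
apply: leq_trans (_ : _ <= \sum_(e <- E | e == e0) b e) _.
  rewrite [X in _ <= X]big_mkcond /=; apply: leq_sum => e _.
  by case: (e == e0); case: (~~ _) => //; rewrite ?mul1n ?mul0n.
case: (boolP (e0 \in E)) => h; last first.
  rewrite big1_seq // => e /andP[/eqP-> h']; by rewrite h' in h.
by rewrite -big_filter filter_pred1_uniq // big_seq1.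
Qed.
End Walks.

Definition val_edge n (e : 'I_n * 'I_n) : edge := (val e.1, val e.2).

Lemma val_edge_inj n : injective (@val_edge n).
Proof. by move=> [u v] [u' v'] [/val_inj-> /val_inj->]. Qed.

Definition raw_of (G : instance) : raw_instance :=
  ([seq val v | v : 'I_(nv G) <- enum 'I_(nv G)],
    ([seq (val_edge e, len e) | e <- enum (edges G)],
      ([seq (val_edge e, Dist e) | e <- enum (demands G)], hopbound G))).

Lemma enc_raw_of G : enc (raw_of G) = enc_instance G.
Proof.
rewrite /enc_instance /enc /Enc_prod /Enc_seq /raw_of /= /enc_weighted /Enc_nat.
by rewrite -!map_comp.
Qed.

Lemma uniq_steps (T : eqType) (u : T) p :
  uniq (u :: p) -> uniq (steps u p) && all (fun e => e.1 != e.2) (steps u p).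
Proof.
move=> un; rewrite /steps zip_uniql //=.
elim: p u un => //= v p IH u; rewrite inE negb_or -!andbA => /and4P[uv _ vp up].
by rewrite uv IH //= vp.
Qed.

Section Ord.
Variable (G : instance).
Local Notation V := 'I_(nv G).
Local Notation vs := (raw_of G).1.

Lemma vs_of : vs = iota 0 (nv G).
Proof. exact: val_enum_ord. Qed.

Lemma mem_vs (v : V) : val v \in vs.
Proof. by rewrite vs_of mem_iota /=. Qed.

Lemma nb_vertices_of : nb_vertices (raw_of G) = nv G.
Proof. by rewrite /nb_vertices vs_of size_iota. Qed.

Lemma steps_val (u : V) p : steps (val u) (map val p) = map (@val_edge _) (steps u p).
Proof. by rewrite /steps; elim: p u => //= v p IH u; rewrite -IH. Qed.

Section Paths.
Variables (al : edge -> bool) (l b : edge -> nat) (BIG D k : nat) (s t : V).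
Let w := best (hop_cost al l b BIG) BIG vs (val s) (val t) D k.
Let wc := tcost (hop_cost al l b BIG) BIG (val t) w.

Lemma best_upper p : path (fun u v : V => al (val u, val v)) s p -> last s p = t ->
  size p <= k -> \sum_(e <- path_edges s p) l (val_edge e) <= D ->
  wc <= \sum_(e <- path_edges s p) b (val_edge e).
Proof.
move=> pp pl sz le.
have [||||w' [h1 h2 h3]] := @path_walk al l b BIG vs (val s) D (mem_vs s) (map val p) k.
- by rewrite path_map.
- by apply/allP => v /mapP[v' _ ->]; apply: mem_vs.
- by rewrite size_map.
- by rewrite steps_val big_map.
have [_ h] := best_spec (hop_cost al l b BIG) BIG (val t) D k (mem_vs s).
apply: leq_trans (h _ h1) _; rewrite /tcost h2 last_map pl eqxx addn0.
by apply: leq_trans h3 _; rewrite steps_val big_map.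
Qed.

Lemma best_lower : wc < BIG -> exists p,
  [/\ is_path (fun u v : V => al (val u, val v)) s t p, size p <= k,
      \sum_(e <- path_edges s p) l (val_edge e) <= D
    & {in path_edges s p, forall e, val_edge e \in [seq hop_edge m | m <- w]}].
Proof.
have [hw _] := best_spec (hop_cost al l b BIG) BIG (val t) D k (mem_vs s).
rewrite /wc /tcost -/w; case: eqP => [et|_]; last by rewrite ltnNge leq_addl.
rewrite addn0 => lt.
have [p [pp pl sz le /andP[/andP[un mv] pvs]]] := walk_path (mem_vs s) hw lt.
have [p' e] : exists p' : seq V, p = map val p'.
  move: pvs; rewrite vs_of; elim: (p) => [|v p1 IH] /=; first by exists [::].
  rewrite mem_iota add0n => /andP[lev /IH[p' ->]].
  by exists (Ordinal lev :: p').
subst p; exists p'; split.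
- rewrite /is_path; move: pp; rewrite path_map => -> /=.
  rewrite -(inj_eq val_inj) -(last_map val) pl [(head _ _).2.1]et eqxx /=.
  by move: un; rewrite -map_cons map_inj_uniq //; exact: val_inj.
- by rewrite size_map in sz.
- have /andP[_] := dp_walk_head (mem_vs s) hw.
  by apply: leq_trans; apply: leq_trans le; rewrite steps_val big_map.
- by move=> e ep; move/allP: mv; apply; rewrite steps_val; apply: map_f.
Qed.

Lemma best_weight : wc < BIG ->
  \sum_(e : V * V | e.1 != e.2) (val_edge e \in [seq hop_edge m | m <- w]) * b (val_edge e) <= wc.
Proof.
have [hw _] := best_spec (hop_cost al l b BIG) BIG (val t) D k (mem_vs s).
move=> lt; apply: leq_trans (leq_addr _ _).
have lt' : wcost (hop_cost al l b BIG) w < BIG by apply: leq_ltn_trans lt; exact: leq_addr.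
have := @walk_weight al l b BIG vs (val s) D k w [seq val_edge e | e <- enum {: V * V}] hw lt'.
rewrite map_inj_uniq ?enum_uniq; last exact: val_edge_inj.
by rewrite big_map big_enum_cond; apply.
Qed.

Lemma best_path_weight p : wc < BIG ->
  uniq (s :: p) -> {in path_edges s p, forall e, val_edge e \in [seq hop_edge m | m <- w]} ->
  \sum_(e <- path_edges s p) b (val_edge e) <= wc.
Proof.
move=> lt un sub; apply: leq_trans (best_weight lt).
have /andP[un' /allP ne] := uniq_steps un.
rewrite big_uniq //= big_mkcond [X in _ <= X]big_mkcond; apply: leq_sum => e _.
by case: ifP => // ep; rewrite ne // sub // mul1n.
Qed.
End Paths.

Lemma in_E_of (e : V * V) : in_E (raw_of G) (val_edge e) = (e \in edges G).
Proof.
rewrite /in_E /= big_map lt0n sum_nat_seq_neq0 /=.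
apply/hasP/idP => [[e' h]|h]; last by exists e; rewrite ?mem_enum // eqxx.
by rewrite (inj_eq (@val_edge_inj _)) eqb0 negbK => /eqP<-; rewrite -mem_enum.
Qed.

Lemma edge_len_of (e : V * V) : e \in edges G -> edge_len (raw_of G) (val_edge e) = len e.
Proof.
move=> h; rewrite /edge_len /= big_map big_enum /= (bigD1 e) //= eqxx mul1n.
rewrite big1 ?addn0 // => e' /andP[_ ne].
by rewrite (inj_eq (@val_edge_inj _)) (negPf ne).
Qed.

Lemma is_path_size (a : rel V) u v p : is_path a u v p -> size p < nv G.
Proof.
case/and3P=> _ _ un; have := max_card (mem (u :: p)); rewrite (card_uniqP un).
by rewrite card_ord.
Qed.

Variable q : {poly nat}.
Hypothesis Gq : lengths_bounded q G.

Lemma path_G (p : seq V) u : path (fun u v : V => in_E (raw_of G) (val u, val v)) u p = path (@G_rel G) u p.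
Proof. by apply: eq_path => x y /=; exact: (in_E_of (x, y)). Qed.

Lemma path_edges_rel (a : rel V) u p : path a u p -> {in path_edges u p, forall e, a e.1 e.2}.
Proof.
rewrite /path_edges; elim: p u => //= v p IH u /andP[uv vp] e; rewrite inE => /orP[/eqP->//|].
exact: IH.
Qed.

Lemma path_len_edge_len u p : path (@G_rel G) u p ->
  \sum_(e <- path_edges u p) edge_len (raw_of G) (val_edge e) = path_len (@len G) u p.
Proof.
move=> pp; rewrite /path_len; apply: eq_big_seq => -[x y] /(path_edges_rel pp) h.
by rewrite edge_len_of.
Qed.

Lemma size_path_edges (u : V) p : size (path_edges u p) = size p.
Proof. by rewrite size_zip /=; apply/minn_idPr. Qed.

Lemma path_len_le u v p : is_path (@G_rel G) u v p -> path_len (@len G) u p <= nv G * q.[nv G]%R.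
Proof.
move=> h; have sz := is_path_size h; case/and3P: h => pp _ _.
apply: leq_trans (_ : _ <= \sum_(e <- path_edges u p) q.[nv G]%R) _.
  rewrite /path_len big_seq_cond [X in _ <= X]big_seq_cond; apply: leq_sum => -[x y] /andP[+ _].
  by move/(path_edges_rel pp) => /Gq/andP[].
by rewrite big_const_seq count_predT iter_addn_0 size_path_edges mulnC leq_mul2r ltnW ?orbT.
Qed.

Lemma dist_upper (e : V * V) p : is_path (@G_rel G) e.1 e.2 p ->
  dist q (raw_of G) (val_edge e) <= path_len (@len G) e.1 p.
Proof.
move=> h; have sz := is_path_size h; case/and3P: h => pp /eqP pl _.
rewrite -path_len_edge_len //; apply: best_upper => //.
- by rewrite path_G.
- by rewrite nb_vertices_of ltnW.
- by rewrite big1.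
Qed.

Lemma dist_lower (e : V * V) : in_EM q (raw_of G) (val_edge e) ->
  exists2 p, is_path (@G_rel G) e.1 e.2 p & path_len (@len G) e.1 p <= dist q (raw_of G) (val_edge e).
Proof.
move=> lt; have [p [h1 h2 h3 h4]] := best_lower lt.
have {}h1 : is_path (@G_rel G) e.1 e.2 p by move: h1; rewrite /is_path path_G.
exists p => //; have /and3P[pp _ un] := h1.
rewrite -path_len_edge_len //; exact: (best_path_weight lt un h4).
Qed.

Lemma in_EM_of (e : V * V) : in_EM q (raw_of G) (val_edge e) = (e \in E_M G).
Proof.
rewrite inE; apply/idP/connectP => [/dist_lower[p /and3P[pp /eqP pl _] _]|[p pp pl]].
  by exists p.
case/shortenP: pp pl => p' pp' un _ pl.
have ip : is_path (@G_rel G) e.1 e.2 p' by rewrite /is_path pp' pl eqxx un.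
rewrite /in_EM; apply: leq_ltn_trans (dist_upper ip) _; rewrite /dist_penalty nb_vertices_of ltnS.
exact: path_len_le ip.
Qed.

Lemma dist_of (e : V * V) : e \in E_M G -> dist q (raw_of G) (val_edge e) = dG e.
Proof.
rewrite -in_EM_of => /dist_lower[p ip le].
rewrite /dG; case: boolp.pselect => [h|[]]; last first.
  by exists (path_len (@len G) e.1 p); apply/boolp.asboolP; exists p.
case: ex_minnP => d /boolp.asboolP[p' ip' <-] hmin; apply/eqP; rewrite eqn_leq.
rewrite (dist_upper ip') /=; apply: leq_trans (hmin _ _) le.
by apply/boolp.asboolP; exists p.
Qed.

Lemma dG_le (e : V * V) : e \in E_M G -> dG e <= nv G * q.[nv G]%R.
Proof.
by move=> h; rewrite -dist_of //; move: h; rewrite -in_EM_of /in_EM /dist_penalty nb_vertices_of ltnS.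
Qed.

End Ord.

(** * Analysis of the queues *)

Section LP.
Local Open Scope ring_scope.

Section Cut.
Variables (R : realType) (G : instance).
Local Notation V := 'I_(nv G).
Implicit Types (y z b : V * V -> R).

Lemma E_M_path s t p : allowed_path s t p -> {in path_edges s p, forall e, e \in E_M G}.
Proof.
by case=> /and3P[pp _ _] _ _ [u v] /(path_edges_rel pp).
Qed.

Lemma sum_path_le (f : V * V -> R) s t p (P : pred (V * V)) :
  (forall e, e \in E_M G -> 0 <= f e) -> allowed_path s t p ->
  \sum_(e <- path_edges s p | P e) f e <= \sum_(e in E_M G | P e) f e.
Proof.
move=> f0 ap; have inM := E_M_path ap; have [/and3P[_ _ un] _ _] := ap.
have /andP[un' _] := uniq_steps un.
rewrite -big_filter big_uniq ?filter_uniq //= big_mkcond [leRHS]big_mkcond /=.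
apply: ler_sum => e _; rewrite mem_filter andbC.
case: (boolP (e \in path_edges s p)) => [/inM h|_] /=; first by rewrite h.
by case: ifP => // /andP[/f0].
Qed.

(* The cut [z] obtained by rescaling [b] off the set [1 <= y] and truncating  *)
(* at 1 tests [y]; no duality is needed.                                      *)
Lemma cut_bound y s t b (m : R) :
  lp_feasible y -> (s, t) \in demands G ->
  (forall e, e \in E_M G -> 0 <= b e) ->
  (forall p, allowed_path s t p -> m <= \sum_(e <- path_edges s p) b e) ->
  m <= \sum_(e in E_M G) b e * Num.min (y e) 1.
Proof.
move=> [yf y0] st b0 hm.
pose A := [pred e | 1 <= y e].
pose g := \sum_(e in E_M G | A e) b e.
have -> : \sum_(e in E_M G) b e * Num.min (y e) 1 =
    g + \sum_(e in E_M G | ~~ A e) b e * y e.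
  rewrite (bigID A) /=; congr (_ + _); apply: eq_bigr => e /andP[_ h].
    by rewrite min_r // mulr1.
  by rewrite min_l // ltW // ltNge.
have r0 : 0 <= \sum_(e in E_M G | ~~ A e) b e * y e.
  by apply: sumr_ge0 => e /andP[h _]; apply: mulr_ge0; [apply: b0|apply: y0].
have [lemg|ltgm] := lerP m g; first by rewrite (le_trans lemg) // lerDl.
have d0 : 0 < m - g by rewrite subr_gt0.
pose z e := if A e then 0 else Num.min 1 (b e / (m - g)).
have z01 e : e \in E_M G -> 0 <= z e <= 1.
  move=> h; rewrite /z; case: ifP => _; first by rewrite lexx ler01.
  apply/andP; split; last by rewrite ge_min lexx.
  by rewrite le_min ler01 divr_ge0 ?b0 ?ltW.
have Zz : Zset s t z.
  split=> // p ap; have inM := E_M_path ap.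
  case: (boolP (has (fun e => ~~ A e && (1 <= b e / (m - g))) (path_edges s p))).
    move=> /hasP[e ep /andP[nA le]]; rewrite (big_rem e) //=.
    rewrite {1}/z (negPf nA) min_l // lerDl big_seq sumr_ge0 // => e' /mem_rem/inM.
    by move/z01/andP => [].
  rewrite -all_predC => /allP hb.
  have -> : \sum_(e <- path_edges s p) z e =
      (\sum_(e <- path_edges s p | ~~ A e) b e) / (m - g).
    rewrite mulr_suml [RHS]big_mkcond; apply: eq_big_seq => e /hb /=.
    rewrite /z /=; case: (1 <= y e) => //=; rewrite -ltNge => lt.
    by rewrite min_r // ltW.
  rewrite ler_pdivlMr // mul1r lerBlDl.
  apply: le_trans (hm p ap) _; rewrite (bigID A) /= lerD2r.
  exact: (sum_path_le (f := b) _ b0 ap).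
have := yf s t st z Zz; rewrite (bigID A) /= big1 ?add0r; last first.
  by move=> e /andP[_ h]; rewrite /z /= h mul0r.
move=> h1; rewrite -lerBlDl.
have : \sum_(e in E_M G | ~~ A e) z e * y e <= (\sum_(e in E_M G | ~~ A e) b e * y e) / (m - g).
  rewrite mulr_suml; apply: ler_sum => e /andP[eM nA].
  rewrite mulrAC ler_wpM2r ?y0 // /z (negPf nA) ge_min lexx orbT //.
by move=> h2; have := le_trans h1 h2; rewrite ler_pdivlMr // mul1r.
Qed.

Lemma feasible_path y s t :
  lp_feasible y -> (s, t) \in demands G -> exists p, allowed_path s t p.
Proof.
move=> [yf _] st; apply: contrapT => np.
have : Zset s t (fun=> 0 : R).
  by split=> [e _|p ap]; [rewrite lexx ler01|case: np; exists p].
move=> /(yf s t st); rewrite big1 ?ler10 // => e _; exact: mul0r.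
Qed.
End Cut.

Lemma budget (R : realFieldType) (dd nn c k t o eps l B QQ : R) :
  0 <= dd -> 0 <= nn -> 0 < c -> 1 <= k -> 0 < t -> 1 <= o -> 1 <= k * eps ->
  2 * dd + nn <= c -> 12 * (c * c) * (k * k * k) <= t -> 0 <= l -> 0 <= B ->
  l + 2 * (c * k) * B <= t * ((2 * (c * k) + 2 * dd) * o + nn) ->
  2 * (6 * c * k ^+ 2) * QQ <= nn * (6 * c * k ^+ 2) ^+ 2 + l ->
  B + QQ <= (1 + eps) * o * t.
Proof.
move=> d0 n0 c0 k1 t0 o1 ke hc ht l0 B0 hp hQ.
have k0 : 0 < k by lra.
have to0 : 0 < t * o by rewrite mulr_gt0 //; lra.
have tto : t <= t * o by rewrite ler_peMr // ltW.
have h1 : l + 2 * (c * k) * B <= t * o * (2 * (c * k) + c).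
  apply: le_trans hp _; rewrite -mulrA ler_pM2l //.
  have : (2 * dd + nn) * o <= c * o by rewrite ler_wpM2r //; lra.
  have : nn * 1 <= nn * o by rewrite ler_wpM2l.
  lra.
have hB : 2 * k * B <= t * o * (2 * k + 1).
  rewrite -(ler_pM2l c0); lra.
have hl : l <= c * k * (3 * (t * o)).
  have : 0 <= c * k * B by rewrite !mulr_ge0 // ltW.
  have : c * (t * o) * 1 <= c * (t * o) * k by rewrite ler_wpM2l // mulr_ge0 ?ltW.
  lra.
have hQ' : 2 * k * QQ <= t * o.
  have ck0 : 0 < c * k by rewrite mulr_gt0.
  have hn : nn * (6 * c * k ^+ 2) ^+ 2 <= c * (6 * c * k ^+ 2) ^+ 2.
    by rewrite ler_wpM2r ?sqr_ge0 //; lra.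
  have hn2 : c * (6 * c * k ^+ 2) ^+ 2 <= c * k * (3 * t).
    rewrite (_ : c * _ = c * k * (3 * (12 * (c * c) * (k * k * k)))); last by ring.
    by rewrite ler_pM2l // ler_pM2l.
  have : c * k * (12 * k * QQ) <= c * k * (6 * (t * o)).
    have : c * k * t <= c * k * (t * o) by rewrite ler_pM2l.
    lra.
  rewrite ler_pM2l //; lra.
have hk : t * o <= (k * eps) * (t * o) by rewrite ler_peMl // ltW.
rewrite -(ler_pM2l k0); lra.
Qed.

Section Core.
Variables (R : realType) (G : instance).
Local Notation V := 'I_(nv G).
Local Notation D := (demands G).
Local Notation Et := (E_tilde G).
Variables (Vt T : nat) (Q F : nat -> V * V -> V * V -> nat) (ph : nat -> V * V -> V * V -> bool).
Let S i e := (\sum_(d in D) Q i d e)%N.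
Let xi i e := (Vt < S i e)%N.
Hypothesis Q0 : forall d e, d \in D -> Q 0 d e = 0%N.
Hypothesis F0 : forall d e, d \in D -> F 0 d e = 0%N.
Hypothesis QS : forall i d e, d \in D -> Q i.+1 d e = (Q i d e + ph i d e - xi i e)%N.
Hypothesis FS : forall i d e, d \in D -> F i.+1 d e = (F i d e + ph i d e)%N.
Hypothesis T0 : (0 < T)%N.
Hypothesis ph_path : forall i d, (i < T)%N -> d \in D ->
  exists2 p, allowed_path d.1 d.2 p & {in path_edges d.1 p, forall e, ph i d e}.
Hypothesis ph_min : forall i d p, (i < T)%N -> d \in D -> allowed_path d.1 d.2 p ->
  (\sum_(e in Et) (Q i d e).+1 * ph i d e <=
   \sum_(e <- path_edges d.1 p | e \notin edges G) (Q i d e).+1)%N.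

Definition core_num e := if e \in edges G then T else (\max_(d in D) F T d e)%N.
Definition core_x e : R := (core_num e)%:R / T%:R.

Lemma F_sum i d e : d \in D -> F i d e = (\sum_(j < i) ph j d e)%N.
Proof.
move=> dD; elim: i => [|i IH]; first by rewrite big_ord0 F0.
by rewrite big_ord_recr /= FS // IH.
Qed.

Lemma F_le d e : d \in D -> (F T d e <= core_num e)%N.
Proof.
move=> dD; rewrite /core_num; case: ifP => _; last exact: leq_bigmax_cond.
rewrite F_sum //; apply: leq_trans (_ : \sum_(j < T) 1 <= _)%N.
  by apply: leq_sum => j _; exact: leq_b1.
by rewrite sum1_card card_ord.
Qed.

Lemma core_feasible : lp_feasible core_x.
Proof.
have T0' : 0 < T%:R :> R by rewrite ltr0n.
split=> [s t st z [z01 zp]|e _]; last by rewrite divr_ge0.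
have z0 e : e \in E_M G -> 0 <= z e by move/z01/andP => [].
have : T%:R <= \sum_(e in E_M G) z e * (F T (s, t) e)%:R.
  rewrite (_ : \sum_(e in E_M G) _ = \sum_(j < T) \sum_(e in E_M G) z e * (ph j (s, t) e)%:R); last first.
    rewrite exchange_big /=; apply: eq_bigr => e _.
    by rewrite F_sum // natr_sum mulr_sumr.
  apply: le_trans (_ : \sum_(j < T) 1 <= _); first by rewrite sumr_const card_ord.
  apply: ler_sum => j _.
  have [p ap sub] := ph_path (ltn_ord j) st; apply: le_trans (zp p ap) _.
  rewrite (_ : \sum_(e <- _) _ = \sum_(e <- path_edges s p) z e * (ph j (s, t) e)%:R); last first.
    by apply: eq_big_seq => e /sub /= ->; rewrite mulr1.
  apply: le_trans (@sum_path_le R G (fun e => z e * (ph j (s, t) e)%:R) s t p xpredT _ ap) _.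
    by move=> e h; rewrite mulr_ge0 ?z0.
  by rewrite [leLHS](eq_bigl (mem (E_M G))) // => e; rewrite andbT.
move=> h; rewrite (_ : \sum_(e in _) _ = (\sum_(e in E_M G) z e * (core_num e)%:R) / T%:R); last first.
  by rewrite mulr_suml; apply: eq_bigr => e _; rewrite mulrA.
rewrite ler_pdivlMr // mul1r; apply: le_trans h _; apply: ler_sum => e /z0 h.
by rewrite ler_wpM2l // ler_nat F_le.
Qed.

Variable y : V * V -> R.
Hypothesis yf : lp_feasible y.
Let y' e := Num.min (y e) 1.
Let O := \sum_(e in Et) y' e.

Lemma EtM e : e \in Et -> e \in E_M G.
Proof. by rewrite inE => /andP[]. Qed.

Lemma y'01 e : e \in Et -> 0 <= y' e <= 1.
Proof.
by move/EtM => /(proj2 yf) h; rewrite /y' le_min h ler01 ge_min lexx orbT.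
Qed.

Lemma O_le : O <= lp_objective y.
Proof. by apply: ler_sum => e _; rewrite ge_min lexx. Qed.

Lemma O_ge0 : 0 <= O.
Proof. by apply: sumr_ge0 => e /y'01/andP[]. Qed.

Lemma cut_tilde d (b : V * V -> nat) m : d \in D ->
  (forall p, allowed_path d.1 d.2 p ->
    m <= \sum_(e <- path_edges d.1 p | e \notin edges G) b e)%N ->
  m%:R <= \sum_(e in Et) (b e)%:R * y' e.
Proof.
case: d => s t st hb.
have := cut_bound (b := fun e => if e \in edges G then 0 else (b e)%:R) (m := m%:R) yf st.
move=> /(_ _ _)/le_trans; apply.
- by move=> e _; case: ifP.
- move=> p /hb; rewrite -(ler_nat R) natr_sum big_mkcond => /le_trans; apply.
  by apply: ler_sum => e _; case: (e \in edges G).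
- rewrite [leRHS]big_mkcond [leLHS]big_mkcond /=; apply: ler_sum => e _.
  by rewrite /E_tilde finset.in_setD; case: (e \in edges G); case: (e \in E_M G); rewrite //= ?mul0r ?lexx.
Qed.

Lemma O_ge1 i d e : (i < T)%N -> d \in D -> e \in Et -> ph i d e -> 1 <= O.
Proof.
move=> iT dD eEt he.
have := @cut_tilde d (fun=> 1%N) 1 dD; rewrite /O => h.
rewrite (_ : \sum_(e in _) _ = \sum_(e in Et) 1%:R * y' e); last by apply: eq_bigr => ? _; rewrite mul1r.
apply: h => p ap; have := ph_min iT dD ap.
have h1 : (0 < \sum_(e in Et) (Q i d e).+1 * ph i d e)%N.
  by rewrite (bigD1 e) //= he muln1.
move=> h2; have := leq_trans h1 h2; rewrite !lt0n.
by rewrite !sum_nat_seq_neq0; apply: sub_has => e' /andP[->].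
Qed.

Let N := (#|D| * #|Et|)%N.
Let L i : R := \sum_(d in D) \sum_(e in Et) (Q i d e)%:R ^+ 2.

Lemma queue_step i d e : d \in D ->
  (Q i.+1 d e)%:R ^+ 2 <= (Q i d e)%:R ^+ 2 +
    2 * (Q i d e)%:R * ((ph i d e)%:R - (xi i e)%:R) + 1 :> R.
Proof.
move=> dD; rewrite QS //; case: (ph i d e); case: (xi i e) => /=.
- by rewrite addnK; lra.
- rewrite subn0 natrD; nra.
- rewrite addn0; case: (Q i d e) => [|k] /=; first by rewrite !sub0n; lra.
  by rewrite subn1 /= mulrSr; lra.
- by rewrite addn0 subn0; lra.
Qed.

(* Greedy choices beat [y']: the path of [d] is cheaper than its [y']-cost by *)
(* [cut_tilde], and [xi] minimizes [(Vt - S) * xi] over [0, 1].               *)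
Lemma potential_step i : (i < T)%N ->
  L i.+1 + 2 * Vt%:R * \sum_(e in Et) (xi i e)%:R <=
  L i + (2 * Vt%:R + 2 * #|D|%:R) * O + N%:R.
Proof.
move=> iT.
have hL : L i.+1 <= L i + 2 * (\sum_(d in D) \sum_(e in Et) (Q i d e)%:R * (ph i d e)%:R)
    - 2 * (\sum_(e in Et) (S i e)%:R * (xi i e)%:R) + N%:R.
  have -> : \sum_(e in Et) (S i e)%:R * (xi i e)%:R =
      \sum_(d in D) \sum_(e in Et) (Q i d e)%:R * (xi i e)%:R :> R.
    rewrite exchange_big /=; apply: eq_bigr => e _.
    by rewrite natr_sum mulr_suml.
  have -> : N%:R = \sum_(d in D) \sum_(e in Et) 1 :> R.
    by rewrite !sumr_const -mulrnA mulnC.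
  rewrite /L !mulr_sumr -big_split -sumrB -big_split /=; apply: ler_sum => d dD.
  rewrite !mulr_sumr -big_split -sumrB -big_split /=; apply: ler_sum => e _.
  apply: le_trans (queue_step i e dD) _; lra.
have hph : \sum_(d in D) \sum_(e in Et) (Q i d e)%:R * (ph i d e)%:R <=
    \sum_(e in Et) (S i e)%:R * y' e + #|D|%:R * O.
  have -> : \sum_(e in Et) (S i e)%:R * y' e + #|D|%:R * O =
      \sum_(d in D) \sum_(e in Et) ((Q i d e).+1)%:R * y' e.
    rewrite -[#|D|%:R]sumr_const mulr_suml.
    rewrite (_ : \sum_(e in Et) (S i e)%:R * y' e = \sum_(d in D) \sum_(e in Et) (Q i d e)%:R * y' e).
      rewrite -big_split /=; apply: eq_bigr => d _; rewrite mul1r /O -big_split /=.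
      by apply: eq_bigr => e _; rewrite mulrSr; lra.
    rewrite exchange_big /=; apply: eq_bigr => e _.
    by rewrite natr_sum mulr_suml.
  apply: ler_sum => d dD; apply: le_trans (cut_tilde dD (fun p ap => ph_min iT dD ap)).
  rewrite natr_sum; apply: ler_sum => e _.
  by rewrite natrM ler_wpM2r // ler_nat.
have hxi : \sum_(e in Et) (Vt%:R - (S i e)%:R) * (xi i e)%:R <=
    \sum_(e in Et) (Vt%:R - (S i e)%:R) * y' e.
  apply: ler_sum => e /y'01/andP[y0 y1]; rewrite /xi; case: ltnP => /=.
    by rewrite -(ltr_nat R) => h; nra.
  by rewrite -(ler_nat R) => h; nra.
have e1 : \sum_(e in Et) (Vt%:R - (S i e)%:R) * (xi i e)%:R =
  Vt%:R * \sum_(e in Et) (xi i e)%:R - \sum_(e in Et) (S i e)%:R * (xi i e)%:R :> R.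
  by rewrite mulr_sumr -sumrB; apply: eq_bigr => e _; rewrite mulrBl.
have e2 : \sum_(e in Et) (Vt%:R - (S i e)%:R) * y' e =
  Vt%:R * O - \sum_(e in Et) (S i e)%:R * y' e :> R.
  by rewrite mulr_sumr -sumrB; apply: eq_bigr => e _; rewrite mulrBl.
rewrite e1 e2 in hxi; move: hL hph hxi.
set a1 := L i.+1; set a2 := L i; set a3 := \sum_(d in D) _.
set a4 := \sum_(e in Et) _ * _; set a5 := \sum_(e in Et) _; set a6 := \sum_(e in Et) _.
lra.
Qed.

Let X i e := (\sum_(j < i) xi j e)%N.

Lemma potential i : (i <= T)%N ->
  L i + 2 * Vt%:R * \sum_(e in Et) (X i e)%:R <=
  i%:R * ((2 * Vt%:R + 2 * #|D|%:R) * O + N%:R).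
Proof.
elim: i => [|i IH] iT.
  rewrite mul0r /L big1 ?add0r => [|d dD]; last first.
    by rewrite big1 // => e _; rewrite Q0 // expr0n.
  by rewrite big1 ?mulr0 // => e _; rewrite /X big_ord0.
have e1 : \sum_(e in Et) (X i.+1 e)%:R = \sum_(e in Et) (X i e)%:R + \sum_(e in Et) (xi i e)%:R :> R.
  by rewrite -big_split /=; apply: eq_bigr => e _; rewrite /X big_ord_recr /= natrD.
rewrite e1 mulrDr mulrSr mulrDl mul1r.
have := IH (ltnW iT); have := potential_step iT; lra.
Qed.

Lemma F_le_XQ i d e : d \in D -> (F i d e <= X i e + Q i d e)%N.
Proof.
move=> dD; elim: i => [|i IH]; first by rewrite F0.
rewrite FS // QS // /X big_ord_recr /= -/(X i e).
by move: IH; lia.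
Qed.

Lemma core_objective (eps : R) (c k : nat) :
  (2 * #|D| + #|D| * #|Et| <= c)%N -> (0 < k)%N -> 1 <= k%:R * eps ->
  Vt = (c * k)%N -> (12 * (c * c) * (k * k * k) <= T)%N ->
  lp_objective core_x <= (1 + eps) * O.
Proof.
move=> hc k0 keps eV hT.
have T0' : 0 < T%:R :> R by rewrite ltr0n.
have k0' : 0 < k%:R :> R by rewrite ltr0n.
have eps0 : 0 < eps by rewrite -(pmulr_rgt0 _ k0'); apply: lt_le_trans keps.
have eobj : lp_objective core_x = (\sum_(e in Et) (\max_(d in D) F T d e)%:R) / T%:R.
  rewrite mulr_suml; apply: eq_bigr => e; rewrite inE => /andP[ne _].
  by rewrite /core_x /core_num (negPf ne).
rewrite eobj ler_pdivrMr //.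
have [[i [d [e [iT dD eEt he]]]]|none] :=
    pselect (exists i d e, [/\ (i < T)%N, d \in D, e \in Et & ph i d e]); last first.
  rewrite big1 => [|e eEt]; first by rewrite !mulr_ge0 ?O_ge0 // ?addr_ge0 // ltW.
  apply/eqP; rewrite pnatr_eq0 -leqn0; apply/bigmax_leqP => d dD.
  rewrite F_sum // big1 // => j _; apply/eqP; rewrite eqb0; apply/negP => h.
  by apply: none; exists j, d, e; split.
have O1 := O_ge1 iT dD eEt he.
have c0 : (0 < c)%N.
  apply: leq_trans hc; rewrite addn_gt0 muln_gt0 /=; apply/orP; left.
  by apply/card_gt0P; exists d.
have hpot := potential (leqnn T).
set B := \sum_(e in Et) (X T e)%:R in hpot.
set QQ : R := \sum_(d in D) \sum_(e in Et) (Q T d e)%:R.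
have hF : \sum_(e in Et) (\max_(d in D) F T d e)%:R <= B + QQ.
  rewrite /QQ exchange_big /= -big_split /=; apply: ler_sum => e' _.
  rewrite -natr_sum -natrD ler_nat; apply/bigmax_leqP => d' d'D.
  apply: leq_trans (F_le_XQ _ _ d'D) _; rewrite leq_add2l.
  by rewrite (bigD1 d') //= leq_addr.
have L0 : 0 <= L T by apply: sumr_ge0 => d' _; apply: sumr_ge0 => e' _; exact: sqr_ge0.
have B0 : 0 <= B by apply: sumr_ge0.
have hQQ (l : R) : 2 * l * QQ <= N%:R * l ^+ 2 + L T.
  have -> : N%:R * l ^+ 2 = \sum_(d in D) \sum_(e in Et) l ^+ 2.
    by rewrite !sumr_const -mulrnA mulr_natl mulnC.
  rewrite -big_split /= mulr_sumr; apply: ler_sum => d' _.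
  rewrite -big_split /= mulr_sumr; apply: ler_sum => e' _.
  by rewrite -subr_ge0; apply: le_trans (sqr_ge0 (l - (Q T d' e')%:R)) _; lra.
apply: le_trans hF _.
apply: (@budget R #|D|%:R N%:R c%:R k%:R T%:R O eps (L T) B QQ) => //.
- by rewrite ltr0n.
- by rewrite ler1n.
- by rewrite -natrM -natrD ler_nat.
- by rewrite -!natrM ler_nat.
- by move: hpot; rewrite eV natrM.
Qed.
End Core.

End LP.

(** * The algorithm on encoded instances *)

Lemma max_lookup (K : eqType) (f : K -> nat) (keys : seq K) k0 :
  k0 \in keys -> \max_(k <- keys) (k == k0) * f k = f k0.
Proof.
move=> h; apply/eqP; rewrite eqn_leq; apply/andP; split.
  by apply/bigmax_leqP_seq => k _ _; case: eqP => [->|_]; rewrite ?mul1n.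
have := @leq_bigmax_seq _ keys xpredT (fun k => (k == k0) * f k) k0 h isT.
by rewrite eqxx mul1n.
Qed.

Section Rounds.
Variables (q : {poly nat}) (prec : nat) (G : instance).
Hypothesis Gq : lengths_bounded q G.
Local Notation V := 'I_(nv G).
Local Notation I := (raw_of G).
Local Notation D := (demands G).

Definition demand_key (d : V * V) : demand := (val_edge d, Dist d).
Definition table_at i := iter i (round_step q prec I) [::].
Definition queue_at i (d e : V * V) := queue_lookup (table_at i) (demand_key d, val_edge e).
Definition flow_at i (d e : V * V) := flow_lookup (table_at i) (demand_key d, val_edge e).
Definition routed_at i (d e : V * V) := routed q prec I (table_at i) (demand_key d) (val_edge e).

Lemma mem_keys (d e : V * V) : d \in D -> (demand_key d, val_edge e) \in table_keys I.
Proof.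
move=> dD; apply: allpairs_f; first by apply: map_f; rewrite mem_enum.
by apply: allpairs_f; apply: mem_vs.
Qed.

Lemma load_of i (e : V * V) : load I (table_at i) (val_edge e) = \sum_(d in D) queue_at i d e.
Proof. by rewrite /load /= big_map big_enum. Qed.

Lemma queue_at_step i d e : d \in D ->
  queue_at i.+1 d e = queue_at i d e + routed_at i d e - (threshold prec I < \sum_(d in D) queue_at i d e).
Proof.
move=> dD; rewrite /queue_at /table_at iterS -/(table_at i) /queue_lookup big_map /=.
by rewrite (max_lookup (fun k => queue_lookup (table_at i) k + routed q prec I (table_at i) k.1 k.2 -
  (threshold prec I < load I (table_at i) k.2)) (mem_keys e dD)) /= load_of.
Qed.

Lemma flow_at_step i d e : d \in D -> flow_at i.+1 d e = flow_at i d e + routed_at i d e.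
Proof.
move=> dD; rewrite /flow_at /table_at iterS -/(table_at i) /flow_lookup big_map /=.
by rewrite (max_lookup
  (fun k => flow_lookup (table_at i) k + routed q prec I (table_at i) k.1 k.2) (mem_keys e dD)).
Qed.

Lemma queue_at_le i d e : queue_at i d e <= i.
Proof.
rewrite /queue_at; apply/bigmax_leqP_seq => y /rounds_bound/and3P[_ h _] _.
by rewrite -[leqRHS]mul1n leq_mul ?leq_b1.
Qed.

Section Step.
Variables (i : nat) (d : V * V).
Hypotheses (iT : i < nb_rounds prec I) (dD : d \in D).
Let wtd := edge_weight I (table_at i) (demand_key d).
Let w := walk q prec I (table_at i) (demand_key d).
Let wc := tcost (walk_cost q prec I (table_at i) (demand_key d)) (walk_penalty prec I) (val d.2) w.

Lemma routed_atE (e : V * V) : routed_at i d e = (e.1 != e.2) && (val_edge e \in [seq hop_edge m | m <- w]).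
Proof.
rewrite /routed_at /routed -(inj_eq val_inj); congr (_ && _).
rewrite lt0n sum_nat_seq_neq0 /=; apply/hasP/mapP => [[m mw]|[m mw e1]].
  by rewrite eqb0 negbK => /eqP<-; exists m.
by exists m => //; rewrite e1 eqxx.
Qed.

Lemma edge_weight_of (e : V * V) : wtd (val_edge e) = if e \in edges G then 0 else (queue_at i d e).+1.
Proof. by rewrite /wtd /edge_weight in_E_of. Qed.

Lemma path_EM (u : V) p :
  path (fun u v : V => in_EM q I (val u, val v)) u p = path (@E_M_rel G) u p.
Proof. by apply: eq_path => x y /=; exact: (in_EM_of Gq (x, y)). Qed.

Lemma path_len_dist (u : V) p : path (@E_M_rel G) u p ->
  \sum_(e <- path_edges u p) dist q I (val_edge e) = path_len (@dG G) u p.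
Proof.
move=> pp; rewrite /path_len; apply: eq_big_seq => -[x y] /(path_edges_rel pp) h.
by rewrite (dist_of Gq).
Qed.

Lemma wc_le p : allowed_path d.1 d.2 p -> wc <= \sum_(e <- path_edges d.1 p) wtd (val_edge e).
Proof.
move=> [ip sz le]; have szn := is_path_size ip; have /and3P[pp /eqP pl _] := ip.
apply: best_upper => //.
- by rewrite path_EM.
- by rewrite leq_min sz nb_vertices_of ltnW.
- rewrite path_len_dist // leq_min -surjective_pairing in le *; rewrite le /=.
  apply: leq_trans (_ : _ <= \sum_(e <- path_edges d.1 p) nv G * q.[nv G]%R) _.
    rewrite /path_len big_seq_cond [X in _ <= X]big_seq_cond; apply: leq_sum => -[x y] /andP[+ _].
    by move/(path_edges_rel pp) => h; apply: (dG_le Gq).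
  rewrite big_const_seq count_predT iter_addn_0 size_path_edges mulnC /max_length nb_vertices_of leq_mul2r.
  by rewrite ltnW ?orbT.
Qed.

Lemma wc_small p : allowed_path d.1 d.2 p -> wc < walk_penalty prec I.
Proof.
move=> ap; apply: leq_ltn_trans (wc_le ap) _; rewrite /walk_penalty ltnS nb_vertices_of.
have [ip _ _] := ap; have szn := is_path_size ip.
apply: leq_trans (_ : _ <= \sum_(e <- path_edges d.1 p) (nb_rounds prec I).+1) _.
  apply: leq_sum => e _; rewrite edge_weight_of; case: ifP => // _.
  by rewrite ltnS; apply: leq_trans (queue_at_le _ _ _) (ltnW iT).
rewrite big_const_seq count_predT iter_addn_0 size_path_edges mulnC leq_mul2r.
by rewrite ltnW ?orbT.
Qed.

Lemma routed_at_path p0 : allowed_path d.1 d.2 p0 ->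
  exists2 p, allowed_path d.1 d.2 p & {in path_edges d.1 p, forall e, routed_at i d e}.
Proof.
move=> ap0; have [p [ip sz le sub]] := best_lower (wc_small ap0).
have {}ip : is_path (@E_M_rel G) d.1 d.2 p by move: ip; rewrite /is_path path_EM.
have /and3P[pp _ un] := ip.
exists p.
  split=> //; first by apply: leq_trans sz (geq_minl _ _).
  by rewrite -path_len_dist // -surjective_pairing; apply: leq_trans le (geq_minl _ _).
move=> e ep; rewrite routed_atE sub // andbT.
by have /andP[_ /allP/(_ e ep)] := uniq_steps un.
Qed.

Lemma routed_at_min p : allowed_path d.1 d.2 p ->
  \sum_(e in E_tilde G) (queue_at i d e).+1 * routed_at i d e <=
  \sum_(e <- path_edges d.1 p | e \notin edges G) (queue_at i d e).+1.
Proof.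
move=> ap.
have -> : \sum_(e <- path_edges d.1 p | e \notin edges G) (queue_at i d e).+1 =
    \sum_(e <- path_edges d.1 p) wtd (val_edge e).
  by rewrite big_mkcond; apply: eq_bigr => e _; rewrite edge_weight_of; case: (e \in edges G).
apply: leq_trans (wc_le ap).
apply: leq_trans (best_weight (wc_small ap)).
rewrite big_mkcond [X in _ <= X]big_mkcond; apply: leq_sum => e _.
rewrite routed_atE -/wtd edge_weight_of; case: ifP => //; rewrite finset.in_setD => /andP[/negPf-> _].
by case: (e.1 != e.2); rewrite ?muln0 // mulnC.
Qed.
End Step.

Lemma numerator_of (e : V * V) : numerator prec I (table_at (nb_rounds prec I)) (val_edge e) =
  core_num (nb_rounds prec I) flow_at e.
Proof.
rewrite /numerator in_E_of /core_num; case: ifP => // _.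
by rewrite /= big_map big_enum.
Qed.

Lemma enc_output :
  enc (output q prec I) = enc_fractions (core_num (nb_rounds prec I) flow_at) (fun=> nb_rounds prec I).
Proof.
rewrite /enc_fractions /output /enc /Enc_seq /= -!map_comp; congr dlist.
apply: eq_map => u /=; rewrite -!map_comp; congr dlist; apply: eq_map => v /=.
by rewrite /Enc_prod /= -[(val u, val v)]/(val_edge (u, v)) numerator_of.
Qed.

End Rounds.

Lemma output_approx (R : realType) (eps : R) (q : {poly nat}) (prec : nat) (G : instance) :
  (0 < eps)%R -> 0 < prec -> (1 <= prec%:R * eps)%R -> lengths_bounded q G ->
  approx_solution G eps (enc (output q prec (raw_of G))).
Proof.
move=> eps0 kk0 kke Gq [y0 y0f].
set T := nb_rounds prec (raw_of G).
have Q0 d e : d \in demands G -> queue_at q prec 0 d e = 0 by rewrite /queue_at /queue_lookup big_nil.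
have F0 d e : d \in demands G -> flow_at q prec 0 d e = 0 by rewrite /flow_at /flow_lookup big_nil.
have QS i d e := @queue_at_step q prec G i d e.
have FS i d e := @flow_at_step q prec G i d e.
have hpath i d : i < T -> d \in demands G ->
    exists2 p, allowed_path d.1 d.2 p & {in path_edges d.1 p, forall e, routed_at q prec i d e}.
  move=> iT dD; have [|p ap] := @feasible_path R G y0 d.1 d.2 y0f.
    by rewrite -surjective_pairing.
  exact: (routed_at_path (prec := prec) Gq iT ap).
have hmin i d p (iT : i < T) (dD : d \in demands G) := @routed_at_min q prec G Gq i d iT p.
exists (core_x R T (@flow_at q prec G)); split.
- exists (core_num T (@flow_at q prec G)), (fun=> T); split=> //; exact: enc_output.
- exact: (core_feasible R F0 FS _ hpath).
have hc : 2 * #|demands G| + #|demands G| * #|E_tilde G| <= slack (raw_of G).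
  rewrite /slack nb_vertices_of; have h1 := max_card (demands G); have h2 := max_card (E_tilde G).
  rewrite card_prod card_ord in h1 h2.
  move: h1 h2; move: (nv G * nv G) (#|demands G|) (#|E_tilde G|) => n2 a b h1 h2.
  have : a * b <= n2 * n2 by apply: leq_mul.
  have : n2 <= n2 * n2 by case: (n2) => // n; rewrite leq_pmulr.
  lia.
have hT : 12 * (slack (raw_of G) * slack (raw_of G)) * (prec * prec * prec) <= T by exact: leqnSn.
have bound (y : 'I_(nv G) * 'I_(nv G) -> R) : lp_feasible y ->
    (lp_objective (core_x R T (@flow_at q prec G)) <= (1 + eps) * lp_objective y)%R.
  move=> yf; have T0 : 0 < T by [].
  apply: le_trans (core_objective Q0 F0 QS FS T0 hmin yf hc kk0 kke (erefl _) hT) _.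
  by rewrite ler_wpM2l ?O_le // addr_ge0 // ltW.
have e1 : (0 < 1 + eps)%R by rewrite addr_gt0.
rewrite mulrC -ler_pdivrMr //; apply: lb_le_inf; first by exists (lp_objective y0), y0.
by move=> _ [y yf <-]; rewrite ler_pdivrMr // mulrC; exact: bound.
Qed.

Local Open Scope ring_scope.

Theorem theorem6 (R : realType) (eps : R) (q : {poly nat}) (heps : 0 < eps) :
  poly_time_solvable (lengths_bounded q) enc_instance
    (fun (G : instance) (r : data) => approx_solution G eps r).
Proof.
pose prec := (Num.bound eps^-1).+1.
have [p [t [hrun [P hP]]]] := pt_reindex raw_of (PT_output q prec).
exists p, P => G Gq; exists (enc (output q prec (raw_of G))), (t G); split.
- by rewrite -enc_raw_of; exact: hrun.
- by rewrite -enc_raw_of; exact: hP.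
- apply: output_approx => //; rewrite -ler_pdivrMr // mul1r.
  apply: le_trans (ltW (archi_boundP _)) _; first by rewrite invr_ge0 ltW.
  by rewrite ler_nat.
Qed.
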